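(* Let $D'$ be a Go-diagram in some partition $\lambda\in\Lambda_{k,n}$, and let $c\prec c'$ be a crossing and uncrossing pair in $D'$ with $D'(c)=\circ$. Suppose the pipes passing through $c$ are labelled $i$ and $i+1$ for some $1\le i<n$. Let $D$ be the diagram obtained from $D'$ by replacing the stones at $c$ and $c'$ with $+$. Then $D$ is a Go-diagram and $\mathcal{D}_{D'}\subset\overline{\mathcal{D}_D}$.
   Context: **Partitions and pipe dreams.** Let $k\le n$ be natural numbers. $\Lambda_{k,n}$ is the set of partitions $\lambda=(\lambda_1\ge\dots\ge\lambda_k\ge 0)$ with $\lambda_1\le n-k$; $\lambda$ is identified with its Young diagram (English notation) in the top-left corner of a rectangle with $k$ rows and $n-k$ columns. The south-east border of $\lambda$ is the lattice path from the north-east corner to the south-west corner of the rectangle bounding $\lambda$; its $n$ unit edges are labelled $1,\dots,n$ starting from the north-east end. The north-west border consists of the top side of the rectangle ($n-k$ edges, the north boundary) and its left side ($k$ edges, the west boundary). For cells $b,c$ write $b\prec c$ if $c$ is weakly north-west of $b$. A pipe dream on $\lambda$ is a filling of every cell by a crossing tile or an elbow tile. Pipe $j$ starts at the south-east border edge labelled $j$ and travels to the north-west border: it enters each cell through its east or south edge; in a crossing tile east continues to west and south continues to north; in an elbow tile east turns to north and south turns to west. Given a pipe dream, write $+$ in each elbow cell; in a crossing cell write $\circ$ (white stone, point of crossing) if the pipe entering from the east has the smaller index of the two pipes, and $\bullet$ (black stone, point of uncrossing) if the pipe entering from the east has the larger index. A pipe dream is a Go-diagram if in no elbow cell the pipe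 entering from the east has larger index than the pipe entering from the south. $D(b)$ denotes the symbol at cell $b$. Replacing a stone by $+$ means replacing the crossing tile by an elbow tile. Cells $c\prec c'$ form a crossing-uncrossing pair if the same two pipes pass through both, $c$ is a point of crossing ($\circ$), $c'$ is a point of uncrossing ($\bullet$), and the two pipes do not cross each other at any cell strictly between $c$ and $c'$. **Deodhar components.** $\mathbb F$ is $\mathbb R$ or $\mathbb C$, $\mathbb F^*=\mathbb F\setminus\{0\}$. $Gr_{k,n}$ is the Grassmannian of $k$-dimensional subspaces of $\mathbb F^n$; a $k\times n$ matrix realizes $V$ if its rows form a basis of $V$ in the standard basis. For $1\le i\le n-1$ let $\phi_i:SL_2(\mathbb F)\to SL_n(\mathbb F)$ embed $\begin{pmatrix}a&b\\c&d\end{pmatrix}$ as the diagonal block in rows and columns $n-i,\,n-i+1$ (so $a$ is the $(i+1)$-th diagonal entry from the bottom), identity elsewhere. Put $x_i(p)=\phi_i\begin{pmatrix}1&p\\0&1\end{pmatrix}$, $y_i(p)=\phi_i\begin{pmatrix}1&0\\ p&1\end{pmatrix}$, $\dot s_i=\phi_i\begin{pmatrix}0&-1\\1&0\end{pmatrix}$. Attach to the cell in row $r$, column $c$ of $\lambda$ the index $n-k+r-c$. A reading word on $\lambda$ is a bijective filling of the cells with $1,\dots,m$ ($m=|\lambda|$) decreasing left to right in rows and top to bottom in columns. Fix one, let $b_l$ be the cell with entry $l$ and $i_l$ the index attached to it. For a Go-diagram $D$ let $G_D$ be the set of products $g=g_1g_2\cdots g_m$ with $g_l=x_{i_l}(q_l)\dot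 s_{i_l}^{-1}$, $q_l\in\mathbb F$, if $D(b_l)=\bullet$; $g_l=y_{i_l}(p_l)$, $p_l\in\mathbb F^*$, if $D(b_l)=+$; $g_l=\dot s_{i_l}$ if $D(b_l)=\circ$. The Deodhar component $\mathcal D_D\subset Gr_{k,n}$ is the set of row spans of the $k\times n$ matrices $A$ with $A_{r,j}=g_{n+1-j,\,r}$, $g\in G_D$ (i.e. the span of the first $k$ columns of $g$, coordinates read from bottom to top). It does not depend on the reading word. The bar denotes closure in $Gr_{k,n}$ in the usual (Euclidean) topology. *)

(* Defs.v *)
From HB Require Import structures.
From mathcomp Require Import all_boot all_order all_algebra.
From mathcomp Require Import boolp classical_sets reals topology normedtype.
From mathcomp Require Import complex.

Set Implicit Arguments.
Unset Strict Implicit.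
Unset Printing Implicit Defensive.

Import Order.TTheory GRing.Theory Num.Theory.
Import numFieldNormedType.Exports.

Local Open Scope ring_scope.
Local Open Scope classical_set_scope.

(* Rows and columns are numbered from 0; pipes and border edges from 1. *)
Definition cell : Type := nat * nat.

Definition is_partition (k n : nat) (lam : seq nat) : Prop :=
  [/\ size lam = k, sorted geq lam & all (fun l => (l <= n - k)%N) lam].

Definition in_shape (lam : seq nat) (b : cell) : bool :=
  (b.2 < nth 0%N lam b.1)%N.

(* [prec b c] is b ≺ c: [c] is weakly north-west of [b]. *)
Definition prec (b c : cell) : bool := (c.1 <= b.1)%N && (c.2 <= b.2)%N.

Inductive tile : Type := Crossing | Elbow.

(* Only the values on the cells of the shape are ever used. *)
Definition pipe_dream : Type := cell -> tile.

Inductive side : Type := East | South.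

(* The border path, followed from the north-east corner, has taken
   [n - k - lam_r] west steps and [r] south steps before the edge at the end of
   row [r] ... *)
Definition row_label (k n : nat) (lam : seq nat) (r : nat) : nat :=
  ((n - k - nth 0%N lam r) + r).+1.

(* ... and [n - k - c - 1] west steps and as many south steps as there are
   cells in column [c] before the edge at the bottom of column [c]. *)
Definition col_label (k n : nat) (lam : seq nat) (c : nat) : nat :=
  (n - k - c + count (fun l => (c < l)%N) lam)%N.

(* Label of the pipe entering the cell [(r, c)] through the side [s], found by
   following it back to the south-east border; [fuel] bounds the number of
   cells visited, see [pipe_inE]. *)
Fixpoint pipe_in_rec (k n : nat) (lam : seq nat) (D : pipe_dream)
    (fuel : nat) (s : side) (r c : nat) {struct fuel} : nat :=
  if fuel is fuel'.+1 then
    match s with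
    | East =>
        if in_shape lam (r, c.+1) then
          let s' := if D (r, c.+1) is Crossing then East else South in
          pipe_in_rec k n lam D fuel' s' r c.+1
        else row_label k n lam r
    | South =>
        if in_shape lam (r.+1, c) then
          let s' := if D (r.+1, c) is Crossing then South else East in
          pipe_in_rec k n lam D fuel' s' r.+1 c
        else col_label k n lam c
    end
  else 0%N.

Definition pipe_in (k n : nat) (lam : seq nat) (D : pipe_dream)
    (s : side) (b : cell) : nat :=
  pipe_in_rec k n lam D n s b.1 b.2.

Lemma in_shape_lt (k n : nat) (lam : seq nat) (b : cell) :
  is_partition k n lam -> in_shape lam b -> (b.1 < k)%N && (b.2 < n - k)%N.
Proof.
case=> szl _ /allP lel; rewrite /in_shape; case: (ltnP b.1 k) => [bk|kb].
  by move=> lt; apply: leq_trans lt (lel _ (mem_nth _ _)); rewrite szl.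
by rewrite nth_default ?szl.
Qed.

Lemma pipe_in_rec_fuel (k n : nat) (lam : seq nat) (D : pipe_dream)
    (m1 m2 : nat) (s : side) (r c : nat) :
  is_partition k n lam -> in_shape lam (r, c) ->
  ((k - r) + (n - k - c) <= m1.+1)%N -> ((k - r) + (n - k - c) <= m2.+1)%N ->
  pipe_in_rec k n lam D m1 s r c = pipe_in_rec k n lam D m2 s r c.
Proof.
move=> hl; elim: m1 m2 s r c => [|m1 IH] m2 s r c hb;
  case/andP: (in_shape_lt hl hb) => /= rk ck;
  have er : (k - r = (k - r.+1).+1)%N by [rewrite -subSn];
  have ec : (n - k - c = (n - k - c.+1).+1)%N by [rewrite -subSn].
  by rewrite er ec addnS.
case: m2 => [|m2] h1 h2; first by move: h2; rewrite er ec addnS.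
rewrite /=; case: s; case: ifP => // hb'; apply: IH => //.
- by move: h1; rewrite ec addnS ltnS.
- by move: h2; rewrite ec addnS ltnS.
- by move: h1; rewrite er addSn ltnS.
- by move: h2; rewrite er addSn ltnS.
Qed.

Lemma pipe_inE (k n : nat) (lam : seq nat) (D : pipe_dream) (s : side)
    (r c : nat) :
  (k <= n)%N -> is_partition k n lam -> in_shape lam (r, c) ->
  pipe_in k n lam D s (r, c) =
  match s with
  | East =>
      if in_shape lam (r, c.+1) then
        pipe_in k n lam D
          (if D (r, c.+1) is Crossing then East else South) (r, c.+1)
      else row_label k n lam r
  | South =>
      if in_shape lam (r.+1, c) then
        pipe_in k n lam D
          (if D (r.+1, c) is Crossing then South else East) (r.+1, c)
      else col_label k n lam c
  end.
Proof.
move=> kn hl hb; rewrite /pipe_in /=.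
have le r' c' : ((k - r') + (n - k - c') <= n)%N.
  by rewrite -[leqRHS](subnKC kn) leq_add ?leq_subr.
rewrite (@pipe_in_rec_fuel _ _ _ _ _ n.+1) //=; last 2 first.
- exact: leqW.
- by rewrite leqW // leqW.
Qed.

Definition pipes (k n : nat) (lam : seq nat) (D : pipe_dream) (b : cell) :
    seq nat :=
  [:: pipe_in k n lam D East b; pipe_in k n lam D South b].

Inductive symbol : Type := Plus | White | Black.

(* The two pipes through a cell are different, so the last case is that of a
   larger index entering from the east. *)
Definition symbol_at (k n : nat) (lam : seq nat) (D : pipe_dream) (b : cell) :
    symbol :=
  match D b with
  | Elbow => Plus
  | Crossing =>
      if (pipe_in k n lam D East b < pipe_in k n lam D South b)%N
      then White else Black
  end.

Definition go_diagram (k n : nat) (lam : seq nat) (D : pipe_dream) : Prop :=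
  forall b : cell, in_shape lam b -> D b = Elbow ->
    ~ (pipe_in k n lam D South b < pipe_in k n lam D East b)%N.

Definition crossing_uncrossing_pair (k n : nat) (lam : seq nat)
    (D : pipe_dream) (c c' : cell) : Prop :=
  [/\ in_shape lam c /\ in_shape lam c',
      prec c c',
      perm_eq (pipes k n lam D c) (pipes k n lam D c'),
      symbol_at k n lam D c = White /\ symbol_at k n lam D c' = Black
    & forall b : cell, in_shape lam b -> prec c b -> prec b c' ->
        b <> c -> b <> c' -> D b = Crossing ->
        ~ perm_eq (pipes k n lam D b) (pipes k n lam D c)].

Definition replace_by_elbows (D : pipe_dream) (c c' : cell) : pipe_dream :=
  fun b => if (b == c) || (b == c') then Elbow else D b.

(* A reading word is given by the sequence [b_1; ...; b_m] of the cells ordered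
   by their entries. *)
Definition reading_word (lam : seq nat) (w : seq cell) : Prop :=
  [/\ uniq w,
      forall b : cell, (b \in w) = in_shape lam b,
      forall r c1 c2 : nat, in_shape lam (r, c1) -> in_shape lam (r, c2) ->
        (c1 < c2)%N -> (index (r, c2) w < index (r, c1) w)%N
    & forall r1 r2 c : nat, in_shape lam (r1, c) -> in_shape lam (r2, c) ->
        (r1 < r2)%N -> (index (r2, c) w < index (r1, c) w)%N].

Section Grassmannian.
Variables (F : numFieldType) (k n : nat).

Definition row_span (A : 'M[F]_(k, n)) : {vspace 'rV[F]_n} :=
  <<[seq row r A | r <- enum 'I_k]>>%VS.

Record Gr : Type := MkGr {
  Gr_space :> {vspace 'rV[F]_n};
  _ : \dim Gr_space == k
}.

HB.instance Definition _ := [isSub for Gr_space].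
HB.instance Definition _ := [Choice of Gr by <:].

Definition frames : set 'M[F]_(k, n) := [set A | free [seq row r A | r <- enum 'I_k]].

Lemma dim_row_span (A : frames) : \dim (row_span (val A)) == k.
Proof.
have /set_mem := valP A; rewrite /frames /mkset /free => /eqP fA.
by rewrite /row_span fA size_map size_enum_ord.
Qed.

Definition Gr_of_frame (A : frames) : Gr := MkGr (dim_row_span A).

(* The usual topology of the Grassmannian: the quotient topology along
   [Gr_of_frame], frames being topologized as a subspace of the matrices. *)
Definition Gr_open (U : set Gr) : Prop := open (Gr_of_frame @^-1` U).

Lemma Gr_openT : Gr_open setT.
Proof. exact: openT. Qed.

Lemma Gr_openI (U V : set Gr) : Gr_open U -> Gr_open V -> Gr_open (U `&` V).
Proof. exact: openI. Qed.

Lemma Gr_open_bigU (I : Type) (f : I -> set Gr) :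
  (forall i, Gr_open (f i)) -> Gr_open (\bigcup_i f i).
Proof.
move=> of_; rewrite /Gr_open preimage_bigcup.
by apply: bigcup_open => i _; exact: of_.
Qed.

HB.instance Definition _ :=
  isOpenTopological.Build Gr Gr_openT Gr_openI Gr_open_bigU.

End Grassmannian.

Section Deodhar.
Variables (F : numFieldType) (k n : nat).

(* The block [a b; c d] sits in rows and columns n-i, n-i+1 counted from 1,
   that is n-i-1, n-i counted from 0. *)
Definition phi (i : nat) (a b c d : F) : 'M[F]_n :=
  \matrix_(r, s)
    if (r == n - i.+1 :> nat)%N && (s == n - i.+1 :> nat)%N then a
    else if (r == n - i.+1 :> nat)%N && (s == n - i :> nat)%N then b
    else if (r == n - i :> nat)%N && (s == n - i.+1 :> nat)%N then c
    else if (r == n - i :> nat)%N && (s == n - i :> nat)%N then d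
    else (r == s)%:R.

Definition x_ (i : nat) (p : F) : 'M[F]_n := phi i 1 p 0 1.
Definition y_ (i : nat) (p : F) : 'M[F]_n := phi i 1 0 p 1.
Definition sdot (i : nat) : 'M[F]_n := phi i 0 (-1) 1 0.

(* Unaffected by numbering rows and columns from 0. *)
Definition cell_index (b : cell) : nat := (n - k + b.1 - b.2)%N.

Variable lam : seq nat.

(* [p b] is the parameter q_l or p_l of the cell [b = b_l]. *)
Definition factor (D : pipe_dream) (p : cell -> F) (b : cell) : 'M[F]_n :=
  let i := cell_index b in
  match symbol_at k n lam D b with
  | Black => x_ i (p b) *m invmx (sdot i)
  | Plus => y_ i (p b)
  | White => sdot i
  end.

Definition G_ (w : seq cell) (D : pipe_dream) : set 'M[F]_n :=
  [set g | exists p : cell -> F,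
     (forall b, in_shape lam b -> symbol_at k n lam D b = Plus -> p b != 0) /\
     g = \big[mulmx/1%:M]_(b <- w) factor D p b].

Hypothesis hkn : (k <= n)%N.

Definition bottom_up_mx (g : 'M[F]_n) : 'M[F]_(k, n) :=
  \matrix_(r, j) g (rev_ord j) (widen_ord hkn r).

Definition deodhar (w : seq cell) (D : pipe_dream) : set (Gr F k n) :=
  [set V | exists2 g, G_ w D g & V = row_span (bottom_up_mx g) :> {vspace _}].

End Deodhar.

(* Main.v *)
Require Import Defs.
From mathcomp Require Import all_boot all_order all_algebra.
From mathcomp Require Import perm zify ring.
From mathcomp Require Import boolp classical_sets reals topology normedtype.
From mathcomp Require Import complex.

Set Implicit Arguments.
Unset Strict Implicit.
Unset Printing Implicit Defensive.

Import Order.TTheory GRing.Theory Num.Theory.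
Import numFieldNormedType.Exports.

(** Why the theorem holds. Read the product [g_1 ... g_m] of a Deodhar component
    along the reading word. The cells read so far form a south-east region of
    the shape whose border has [n] steps; matrix row [x] stands for one of these
    steps, and it carries the label of the pipe that crosses it, at the start
    the label [n - x] of an edge of the shape ([pipe_in_labelling]). A crossing
    exchanges the labels of two consecutive rows, an elbow keeps them.

    The first claim is about labels only. From [c] to [c'] the pipes [i] and
    [i.+1] do not meet ([no_meeting]): where they meet for the first time after
    [c], the larger one comes from the east, so the tile is not an elbow, and a
    crossing there would contradict the choice of the pair. Turning [c] and [c']
    into elbows hence exchanges the labels [i] and [i.+1] between the two cells
    and changes nothing else. As the two labels are adjacent, their comparisons
    with all other labels remain, and so do all other symbols ([replace_ltE]).

    For the second claim write an element of the smaller component as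
    [P s Q (x q * s'^-1) T], with the factors [s] of [c] and [x q * s'^-1] of
    [c']. For [t != 0] the matrix [x t * s] is [y (1 / t) * b] for an upper
    triangular [b] ([cross]): an elbow at [c], and an error [b]. On the far right
    of the product an upper triangular matrix would be harmless, because it
    preserves the span of the first [k] columns ([row_span_mul]). So [b] is moved
    to the right, letter by letter, at the cost of new parameters
    ([push_word]). In an elbow and in a white stone this requires that the entry
    of [b] above the diagonal, in the two rows of the cell, is zero. It is,
    because of the following invariant: an entry of [b] is zero when the label
    of its column is smaller than that of its row. At such a letter the label of
    the lower of the two rows, the pipe from the east, is the smaller one. When
    [b] is created, the one exception to the invariant is the entry between the
    pipes [i] and [i.+1]; since these do not meet in [Q], it is never in the way.

    At [c'] this exceptional entry has become [1] or [-1], and it turns the black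
    stone into an elbow ([uncross]). A further factor [x z], with
    [z = t / (t * q + 1)] or [t / (t * q - 1)], inserted behind [c'], removes the
    exception, so that the error can also be moved through [T], where the two
    pipes may meet again. Thus
    [P (x t * s) Q (x q * s'^-1 * x z) T] has the column span of an element of
    the larger component ([deform]). For [t -> 0] also [z -> 0], and this product
    tends to the given element; only the product has to converge, while the
    parameters found for the larger component may well be unbounded. *)

(** * Transpositions of consecutive numbers *)

Definition swap (u x : nat) : nat :=
  if x == u then u.+1 else if x == u.+1 then u else x.

Lemma swapK u : involutive (swap u).
Proof.
by move=> x; rewrite /swap; repeat case: ifP; lia.
Qed.

Lemma swap_lt u x y : (x < y)%N -> ~ (x = u /\ y = u.+1) ->
  (swap u x < swap u y)%N.
Proof. by rewrite /swap; repeat case: ifP; lia. Qed.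

Lemma swap_ltE u x y : ~ perm_eq [:: x; y] [:: u; u.+1] ->
  (swap u x < swap u y)%N = (x < y)%N.
Proof.
move=> h; have h1 : ~ (x = u /\ y = u.+1) by move=> [ex ey]; rewrite ex ey in h.
have h2 : ~ (x = u.+1 /\ y = u).
  by move=> [ex ey]; apply: h; rewrite ex ey (perm_catC [:: u.+1] [:: u]).
by rewrite /swap; repeat case: ifP; lia.
Qed.

Lemma perm_eq_pair (T : eqType) (a b x y : T) : perm_eq [:: a; b] [:: x; y] ->
  (a = x /\ b = y) \/ (a = y /\ b = x).
Proof.
move=> h; have : a \in [:: x; y] by rewrite -(perm_mem h) mem_head.
rewrite !inE => /orP[] /eqP ax.
  by left; move: h; rewrite ax perm_cons => /perm_mem/(_ b); rewrite !inE eqxx => /esym/eqP.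
right; move: h; rewrite ax perm_sym (perm_catC [:: x] [:: y]) perm_cons.
by move=> /perm_mem/(_ x); rewrite !inE eqxx => /esym/eqP ->.
Qed.

Lemma count_ltn_col (s : seq nat) c r : sorted geq s -> (c < nth 0 s r)%N ->
  (nth 0 s r.+1 <= c)%N -> count (fun l => (c < l)%N) s = r.+1.
Proof.
elim: s r => [|a s IH] r /=; first by rewrite nth_nil.
rewrite (@path_sortedE _ geq) => [/andP[ga ss]|]; last first.
  by move=> x y z /= yx zy; apply: leq_trans zy yx.
case: r => [|r] /= h1 h2.
  rewrite h1; congr (_.+1); apply/eqP; rewrite -leqn0 leqNgt -has_count.
  apply/hasPn => x xs; rewrite -leqNgt; apply: leq_trans h2.
  case: s ss xs {IH ga} => //= y s; rewrite (@path_sortedE _ geq).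
    by move=> /andP[/allP hy _]; rewrite inE => /orP[/eqP->|/hy].
  by move=> u v z /= yx zy; apply: leq_trans zy yx.
rewrite (IH r) // (leq_trans h1 _) //.
apply: (allP ga); apply: mem_nth; rewrite ltnNge; apply/negP => hs.
by rewrite nth_default in h1.
Qed.

(** * Labels along a reading word *)

(** The order of the labels of the rows [u] (south edge) and [u.+1] (east edge)
    which the symbol of a cell stands for in a Go-diagram. *)
Definition consistent (f : nat -> nat) (u : nat) (sy : symbol) : bool :=
  if sy is Black then (f u < f u.+1)%N else (f u.+1 < f u)%N.

Section Labels.
Variables (k n : nat) (lam : seq nat).
Implicit Types (D : pipe_dream) (b : cell) (w s : seq cell).

(** The upper one of the two rows on which the factor of the cell acts. Rows are
    counted from the south-west end of the border, so that it belongs to the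
    south edge of the cell, and the row below it to the east edge. *)
Definition south_row (b : cell) : nat := n - (cell_index k n b).+1.

Definition neighbour (e : side) (b : cell) : cell :=
  match e with East => (b.1, b.2.+1) | South => (b.1.+1, b.2) end.

Definition flip (e : side) : side := if e is East then South else East.

Definition edge_row (e : side) (b : cell) : nat :=
  match e with East => (south_row b).+1 | South => south_row b end.

Definition border_label (x : nat) : nat := n - x.

Definition relabel D (sg : nat -> nat) (b : cell) : nat -> nat :=
  if D b is Crossing then sg \o swap (south_row b) else sg.

Definition labelling D w : nat -> nat := foldl (relabel D) border_label w.

Lemma labelling_cat D s1 s2 :
  labelling D (s1 ++ s2) = foldl (relabel D) (labelling D s1) s2.
Proof. exact: foldl_cat. Qed.

Lemma labelling_rcons D s b :
  labelling D (rcons s b) = relabel D (labelling D s) b.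
Proof. by rewrite -cats1 labelling_cat. Qed.

(** The truncated subtraction in [border_label] repeats the label [0], whence the
    positivity. *)
Lemma labelling_inj D w x y :
  labelling D w x = labelling D w y -> (0 < labelling D w x)%N -> x = y.
Proof.
elim/last_ind: w x y => [|w b IH] x y.
  by rewrite /labelling /= /border_label; lia.
rewrite labelling_rcons /relabel; case: (D b) => /=; last exact: IH.
by move=> h1 /(IH _ _ h1) /(can_inj (@swapK _)).
Qed.

Lemma relabel_other D sg b x : x != south_row b -> x != (south_row b).+1 ->
  relabel D sg b x = sg x.
Proof.
by rewrite /relabel /swap => /negbTE h1 /negbTE h2; case: (D b) => //=; rewrite h1 h2.
Qed.

Lemma relabel_edge_row D sg b e :
  relabel D sg b (edge_row e b) =
    sg (edge_row (if D b is Crossing then flip e else e) b).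
Proof.
rewrite /relabel; case: (D b) => //; case: e; rewrite /= /swap ?eqxx //.
by case: eqP => // /esym /n_Sn.
Qed.

Lemma foldl_relabel_comp (f sg : nat -> nat) D0 s :
  foldl (relabel D0) (f \o sg) s = f \o foldl (relabel D0) sg s.
Proof.
elim: s sg => [|b s IH] sg //=; rewrite -IH; congr foldl.
by rewrite /relabel; case: (D0 b).
Qed.

(** Exchanging two adjacent labels is the same as exchanging their places. *)
Lemma swap_labelling D0 s u l : (0 < l)%N ->
  (labelling D0 s u = l /\ labelling D0 s u.+1 = l.+1) \/
  (labelling D0 s u = l.+1 /\ labelling D0 s u.+1 = l) ->
  labelling D0 s \o swap u = swap l \o labelling D0 s.
Proof.
move=> l0 h; apply: funext => x /=.
have hx y : labelling D0 s x = labelling D0 s y -> (0 < labelling D0 s y)%N -> x = y.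
  by move=> e p; apply: labelling_inj (e) _; rewrite e.
have := hx u.+1; have := hx u; rewrite {1}/swap.
have [->|nu] := eqVneq x u; first by rewrite /swap; repeat case: ifP; lia.
have [->|nv] := eqVneq x u.+1; first by rewrite /swap; repeat case: ifP; lia.
by rewrite /swap; repeat case: ifP; lia.
Qed.

Hypotheses (hkn : (k <= n)%N) (hlam : is_partition k n lam).

Lemma in_shape_nw r c r' c' : in_shape lam (r, c) ->
  (r' <= r)%N -> (c' <= c)%N -> in_shape lam (r', c').
Proof.
case: hlam => _ sl _; rewrite /in_shape /= => h hr hc.
apply: leq_ltn_trans hc (leq_trans h _).
case: (ltnP r (size lam)) => hs; last by rewrite nth_default.
have hs' : (r' < size lam)%N by apply: leq_ltn_trans hs.
apply: (@sorted_leq_nth _ geq) => //.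
  by move=> x y z /= yx zy; apply: leq_trans zy yx.
exact: leqnn.
Qed.

 Lemma cell_index_bounds b : in_shape lam b -> (0 < cell_index k n b < n)%N.
Proof.
move=> /(in_shape_lt hlam) /andP[]; rewrite /cell_index; case: b => r c /=.
by move: hkn; lia.
Qed.

Lemma south_rowE b : in_shape lam b ->
  (south_row b + b.1 + n - k = n.-1 + b.2)%N /\ ((south_row b).+1 < n)%N.
Proof.
move=> /[dup] /(in_shape_lt hlam) /andP[]; rewrite /south_row /cell_index.
by case: b => r c /= ? ? _; move: hkn; split; lia.
Qed.

Lemma border_labelE e b : in_shape lam b -> ~~ in_shape lam (neighbour e b) ->
  border_label (edge_row e b) =
  match e with East => row_label k n lam b.1 | South => col_label k n lam b.2 end.
Proof.
case: b => r c; move=> /[dup] hb /[dup] /south_rowE[hs hs'] /(in_shape_lt hlam).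
case/andP => /= rk ck; move: hb hs hs' hkn.
rewrite /border_label /in_shape /row_label /col_label; case: e => /= hb hs hs' hk hn.
  by lia.
rewrite (count_ltn_col (r := r)) //; [by lia | by case: hlam | by lia].
Qed.

Section Word.
Variable w : seq cell.
Hypothesis hw : reading_word lam w.

Lemma notin_split s1 b s2 : w = s1 ++ b :: s2 -> b \notin s1 /\ b \notin s2.
Proof.
move=> ew; case: hw => uw _ _ _; move: uw; rewrite ew cat_uniq cons_uniq.
by case/and4P => _ /hasPn /(_ b (mem_head _ _)).
Qed.

Lemma in_word s1 b s2 : w = s1 ++ b :: s2 -> in_shape lam b.
Proof. by case: hw => _ <- _ _ ->; rewrite mem_cat mem_head orbT. Qed.

(** A reading word lists a cell after all cells of the shape to its
    south-east, so its prefixes are the regions cut off by lattice paths. *)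
Lemma prefix_se s1 b s2 b' : w = s1 ++ b :: s2 ->
  in_shape lam b' -> prec b' b -> b' <> b -> b' \in s1.
Proof.
move=> ew hb' /andP[h1 h2] nb.
case: hw => uw mw hr hc.
have hb := in_word ew.
have wib : index b w = size s1.
  move: uw; rewrite ew cat_uniq => /and3P[_ /hasPn h _].
  rewrite index_cat (negbTE (h b _)) ?mem_head //= eqxx addn0 //.
have : (index b' w < index b w)%N.
  case: b b' hb' hb h1 h2 nb {ew wib} => r c [r' c'] /= hb' hb h1 h2 nb.
  have hm : in_shape lam (r, c') by apply: (in_shape_nw hb').
  have [er|nr] := eqVneq r r'.
    have nc : c' <> c by move=> ec; apply: nb; rewrite er ec.
    by move: hb'; rewrite -er => hb'; apply: hr => //; lia.
  have L1 : (index (r', c') w < index (r, c') w)%N by apply: hc => //; lia.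
  have [ec|nc] := eqVneq c c'; first by rewrite [in X in (_ < index (_, X) _)%N]ec.
  by apply: ltn_trans L1 _; apply: hr => //; lia.
rewrite wib ew index_cat; case: ifP => // _.
by rewrite ltnNge leq_addr.
Qed.

Lemma prefix_not_nw s1 b0 s2 b : w = s1 ++ b0 :: s2 -> b \in s1 ->
  ~~ prec b0 b.
Proof.
move=> ew bs; apply/negP => hp; case: (hw) => uw mw _ _.
have h0 := in_word ew.
move: uw; case/splitPr: bs ew => x y ew uw.
have hb0 : b0 \in x.
  apply: (@prefix_se x b (y ++ b0 :: s2)) => //; first by rewrite ew -catA.
  move=> e; move: uw; rewrite ew e -catA cat_uniq cat_cons cons_uniq.
    by rewrite mem_cat mem_head orbT !andbF.
move: uw; rewrite ew -catA cat_uniq => /and3P[_ /hasPn /(_ b0)].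
by rewrite inE mem_cat mem_head !orbT hb0 => /(_ isT).
Qed.

(** The edge [e] of [b] lies on the border of the region [s] already read. *)
Definition exposed s (e : side) b : Prop :=
  [/\ in_shape lam b, b \notin s & in_shape lam (neighbour e b) -> neighbour e b \in s].

(** Reading [b0] exposes only the edges shared with [b0]. The other exposed edges
    lie on other steps of the border: edges of the same row are translates of
    each other along a diagonal, which the border crosses only once. *)
Lemma exposed_rcons s1 b0 s2 e b : w = s1 ++ b0 :: s2 ->
  exposed (rcons s1 b0) e b ->
  neighbour e b = b0 \/
  [/\ exposed s1 e b, edge_row e b != south_row b0 & edge_row e b != (south_row b0).+1].
Proof.
move=> ew [hb]; rewrite mem_rcons inE negb_or => /andP[/eqP nb bs] hn.
have [->|nn] := eqVneq (neighbour e b) b0; [by left | right].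
have hn' : in_shape lam (neighbour e b) -> neighbour e b \in s1.
  by move/hn; rewrite mem_rcons inE (negbTE nn).
have h0 := in_word ew.
have n1 : ~~ prec b b0.
  by apply/negP => hp; move/negP: bs; apply; apply: (prefix_se ew).
have n2 : ~~ prec b0 (neighbour e b).
  apply/negP => hp; have hs : neighbour e b \in s1.
    apply: hn'; case/andP: hp; case: (b0) h0 (neighbour e b) => r c h [r' c'] /=.
    exact: in_shape_nw.
  by have := prefix_not_nw ew hs; rewrite hp.
have S1 := south_rowE hb; have S2 := south_rowE h0.
split; first by split.
all: clear nn hn hn' hb h0 bs ew; move: S1 S2 n1 n2 nb; rewrite /prec;
  case: e b b0 => [] [r c] [r0 c0] /= [E1 _] [E2 _] n1 n2 nb;
  apply/eqP => e; apply: nb; have [] : r = r0 /\ c = c0 by lia.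
all: by move=> -> ->.
Qed.

Lemma exposed_next s1 b s2 e : w = s1 ++ b :: s2 -> exposed s1 e b.
Proof.
move=> ew; split; first exact: in_word ew.
  by case: (notin_split ew).
move=> hn; apply: (prefix_se ew) => //; case: (b) e {hn} => r c [] /=.
- by rewrite /prec /=; lia.
- by rewrite /prec /=; lia.
- by case=> /esym /n_Sn.
- by case=> /esym /n_Sn.
Qed.

Lemma edge_row_neighbour e b : in_shape lam b -> in_shape lam (neighbour e b) ->
  edge_row e b = edge_row (flip e) (neighbour e b).
Proof.
move=> /south_rowE[+ _] /south_rowE[+ _]; case: b e => r c [] /=; lia.
Qed.

(** The recursion of [pipe_in] follows a pipe back through one cell; along the
    reading word this cell is the last one that moved the label. *)
Lemma pipe_in_exposed D s1 s2 e b : w = s1 ++ s2 -> exposed s1 e b ->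
  pipe_in k n lam D e b = labelling D s1 (edge_row e b).
Proof.
elim/last_ind: s1 s2 e b => [|s1 b0 IH] s2 e b ew.
  case=> hb _ hn; have hn' : ~~ in_shape lam (neighbour e b) by apply/negP => /hn.
  rewrite /labelling /= border_labelE //; case: b e hb {hn} hn' => r c e hb.
  by rewrite (pipe_inE _ _ hkn hlam hb); case: e => /= /negbTE ->.
rewrite cat_rcons in ew; move=> hx.
have [e0|[hx' n1 n2]] := exposed_rcons ew hx; last first.
  by rewrite (IH _ _ _ ew hx') labelling_rcons relabel_other.
case: hx => hb _ _; have := in_word ew; rewrite labelling_rcons -e0 => h0.
rewrite (edge_row_neighbour hb h0) relabel_edge_row e0.
rewrite -(IH _ _ _ ew (exposed_next _ ew)); case: b e hb e0 h0 => r c e hb e0 h0.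
by rewrite (pipe_inE _ _ hkn hlam hb); case: e e0 h0 => /= -> ->; case: (D _).
Qed.

Lemma pipe_in_labelling D s1 b s2 e : w = s1 ++ b :: s2 ->
  pipe_in k n lam D e b = labelling D s1 (edge_row e b).
Proof. by move=> ew; apply: pipe_in_exposed (ew) _; apply: exposed_next ew. Qed.

Lemma labelling_gt0 D s1 s2 x :
  w = s1 ++ s2 -> (x < n)%N -> (0 < labelling D s1 x)%N.
Proof.
elim/last_ind: s1 s2 x => [|s1 b IH] s2 x ew xn.
  by rewrite /labelling /= /border_label subn_gt0.
rewrite cat_rcons in ew; have [_ hu] := south_rowE (in_word ew).
rewrite labelling_rcons /relabel; case: (D b) => /=; apply: (IH _ _ ew) => //.
by rewrite /swap; do 2?case: ifP; lia.
Qed.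

Lemma pipes_neq D s1 b s2 : w = s1 ++ b :: s2 ->
  pipe_in k n lam D East b <> pipe_in k n lam D South b.
Proof.
move=> ew; rewrite !(pipe_in_labelling D _ ew) /= => /labelling_inj h.
have [_ hu] := south_rowE (in_word ew).
by have /esym/n_Sn := h (labelling_gt0 D ew hu).
Qed.

(** A pipe only moves north and west: all edges of its label that become exposed
    after [b1] belong to cells north-west of [b1]. *)
Lemma common_pipe_prec D s1 b1 s2 b2 s3 e1 e2 :
  w = s1 ++ b1 :: s2 ++ b2 :: s3 ->
  pipe_in k n lam D e1 b1 = pipe_in k n lam D e2 b2 -> prec b1 b2.
Proof.
move=> ew; set l := pipe_in _ _ _ _ _ _ => el.
have hl : l = labelling D s1 (edge_row e1 b1) by apply: pipe_in_labelling ew.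
have l0 : (0 < l)%N.
  rewrite hl; apply: (labelling_gt0 _ ew); have [_] := south_rowE (in_word ew).
  by case: (e1) => /=; lia.
have ew' : w = (rcons s1 b1 ++ s2) ++ b2 :: s3 by rewrite ew cat_rcons -catA.
rewrite (pipe_in_labelling D e2 ew') in el.
have := exposed_next e2 ew'; move: el ew'; move: (b2 :: s3) => t; move: b2 t e2 {ew}.
elim/last_ind: s2 => [|s2 b0 IH] b t e el ew hx.
  rewrite cats0 in el ew hx; rewrite cat_rcons in ew.
  have [e0|[hx' n1 n2]] := exposed_rcons ew hx.
    by rewrite -e0; case: (b) (e) => r c []; rewrite /prec /=; lia.
  move: el; rewrite labelling_rcons relabel_other // hl => /(@labelling_inj D) -/(_ _).
  rewrite -hl => /(_ l0) er; move: n1 n2; rewrite -er.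
  by case: (e1) => /=; rewrite eqxx.
rewrite -rcons_cat in el ew hx; rewrite cat_rcons in ew.
have [e0|[hx' n1 n2]] := exposed_rcons ew hx; last first.
  by apply: (IH b (b0 :: t) e) => //; rewrite el labelling_rcons relabel_other.
case: hx => hb _ _; have := in_word ew; rewrite -e0 => h0.
have hp : prec b1 b0.
  apply: (IH b0 (b0 :: t) _ _ ew (exposed_next _ ew)).
  by rewrite el labelling_rcons (edge_row_neighbour hb h0) e0 relabel_edge_row.
by move: hp; rewrite -e0; case: (b1) (b) (e) => r c [r2 c2] []; rewrite /prec /=; lia.
Qed.

(** Reading words respect the order of the pair, because [c'] lies north-west
    of [c]. *)
Lemma word_split D' c c' : crossing_uncrossing_pair k n lam D' c c' ->
  exists w1 w2 w3, w = w1 ++ c :: w2 ++ c' :: w3.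
Proof.
move=> pr; have [[hc hc'] pcc' _ _ _] := pr; have [_ mw _ _] := hw.
have ncc : c <> c' by case: pr => _ _ _ [+ +] _ e; rewrite -e => ->.
have split_at (s : seq cell) b : b \in s -> exists s1 s2, s = s1 ++ b :: s2.
  by case/splitPr => s1 s2; exists s1, s2.
have [|s1 [w3 e]] := split_at w c'; first by rewrite mw.
have [w1 [w2 e1]] := split_at _ _ (prefix_se e hc pcc' ncc).
by exists w1, w2, w3; rewrite e e1 -catA.
Qed.

(** * The pipes of the crossing-uncrossing pair *)

Section Pair.
Variables (D' : pipe_dream) (i : nat) (w1 w2 w3 : seq cell) (c c' : cell).
Hypotheses (hD' : go_diagram k n lam D') (i_gt0 : (0 < i)%N).
Hypothesis ew : w = w1 ++ c :: w2 ++ c' :: w3.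
Hypothesis hcc' : crossing_uncrossing_pair k n lam D' c c'.
Hypothesis hpipes : perm_eq (pipes k n lam D' c) [:: i; i.+1].

Local Notation lab := (pipe_in k n lam D').

Lemma labels_c : [/\ lab East c = i, lab South c = i.+1 & D' c = Crossing].
Proof.
case: hcc' => _ _ _ [+ _] _; rewrite /symbol_at; case: (D' c) => //.
case: ifP => // + _; have [[-> ->]//|[-> ->]] := perm_eq_pair hpipes.
by rewrite ltnNge leqnSn.
Qed.

Lemma labels_c' : [/\ lab East c' = i.+1, lab South c' = i & D' c' = Crossing].
Proof.
case: hcc' => _ _ + [_ +] _; rewrite perm_sym => h; have := perm_trans h hpipes.
rewrite /symbol_at; case: (D' c') => // /perm_eq_pair[] [-> ->] //.
by rewrite ltnSn.
Qed.

(** As long as they have not met again, the two pipes are in the order in which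
    [c] has put them; a Go-diagram allows no elbow where they meet next, so
    they next meet at a crossing, which can only be [c']. *)
Lemma no_meeting x y : w2 = x ++ y ->
  (forall x1 b x2, x = x1 ++ b :: x2 ->
     ~ perm_eq (pipes k n lam D' b) [:: i; i.+1]) /\
  (forall r s : nat, labelling D' (rcons w1 c ++ x) r = i ->
     labelling D' (rcons w1 c ++ x) s = i.+1 -> (r < s)%N).
Proof.
elim/last_ind: x y => [|x b IH] y e2.
  split=> [[]//|r s]; have [lE lS cr] := labels_c.
  rewrite cats0 labelling_rcons /relabel cr /=; move: lE lS.
  rewrite !(pipe_in_labelling D' _ ew) /= => lE lS.
  move=> er es; have hr := @labelling_inj D' w1 _ (swap (south_row c) r) (etrans lE (esym er)).
  have hs := @labelling_inj D' w1 _ (swap (south_row c) s) (etrans lS (esym es)).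
  move: hr hs; rewrite lE lS => /(_ i_gt0) hr /(_ isT).
  by move: hr; rewrite /swap; repeat case: ifP; lia.
rewrite cat_rcons in e2; have [nm lt] := IH _ e2.
have ewb : w = (rcons w1 c ++ x) ++ b :: y ++ c' :: w3.
  by rewrite ew e2 cat_rcons -!catA.
have hb := in_word ewb.
have nb : ~ perm_eq (pipes k n lam D' b) [:: i; i.+1].
  (* By the order of the rows the larger label would enter from the east. *)
  move=> hp; have [eE eS] : lab East b = i.+1 /\ lab South b = i.
    case: (perm_eq_pair hp) => [] [eE eS] //.
    have := lt (south_row b).+1 (south_row b); move: eE eS.
    by rewrite !(pipe_in_labelling D' _ ewb) /= => eE eS /(_ eE eS); lia.
  case eb : (D' b); last by apply: (hD' hb eb); rewrite eE eS.
  have [lcE lcS _] := labels_c; have [lc'E lc'S _] := labels_c'.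
  case: hcc' => _ _ _ _ /(_ b hb); apply => //.
  - apply: (@common_pipe_prec D' w1 c x b (y ++ c' :: w3) East South).
      by rewrite ew e2 -!catA.
    by rewrite lcE eS.
  - apply: (@common_pipe_prec D' (rcons w1 c ++ x) b y c' w3 East East) => //.
    by rewrite eE lc'E.
  - by move=> ebc; move: eE; rewrite ebc lcE => /n_Sn.
  - move=> ebc; case: (hw) => uw _ _ _; move: uw; rewrite ewb ebc.
    by rewrite cat_uniq cons_uniq mem_cat mem_head orbT !andbF.
  - by apply: perm_trans hp _; rewrite perm_sym.
split.
  move=> x1 b' x2; case/lastP: x2 => [|x2 b2].
    by rewrite cats1 => /rcons_inj[_ <-].
  by rewrite -rcons_cons -rcons_cat => /rcons_inj[/nm].
move=> r s; rewrite -rcons_cat labelling_rcons /relabel.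
case eb : (D' b); last exact: lt.
move=> /= er es; have lrs := lt _ _ er es.
rewrite -[r](swapK (south_row b)) -[s](swapK (south_row b)); apply: swap_lt lrs _.
move=> [hr hs]; apply: nb; rewrite /pipes !(pipe_in_labelling D' _ ewb) /=.
by move: er es; rewrite hr hs => -> ->; rewrite (perm_catC [:: i.+1] [:: i]).
Qed.

Local Notation D := (replace_by_elbows D' c c').

Lemma replace_other b : b != c -> b != c' -> D b = D' b.
Proof. by rewrite /replace_by_elbows => /negbTE -> /negbTE ->. Qed.

Lemma foldl_relabel_other s sg : c \notin s -> c' \notin s ->
  foldl (relabel D) sg s = foldl (relabel D') sg s.
Proof.
elim: s sg => [|b s IH] sg //=; rewrite !inE !negb_or => /andP[h1 h2] /andP[h3 h4].
have -> : relabel D sg b = relabel D' sg b by rewrite /relabel replace_other // eq_sym.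
exact: IH.
Qed.

Lemma word_notin : [/\ c \notin w1, c' \notin w1, c \notin w2, c' \notin w2
  & c \notin w3 /\ c' \notin w3].
Proof.
have [h1 h2] := notin_split ew; have ew' : w = (w1 ++ c :: w2) ++ c' :: w3.
  by rewrite ew -catA.
have [h3 h4] := notin_split ew'.
move: h2 h3; rewrite !mem_cat !inE !negb_or.
by move=> /and3P[? _ ?] /and3P[? _ ?].
Qed.

Lemma labelling_before x y : w1 = x ++ y -> labelling D x = labelling D' x.
Proof.
move=> e; have [] := word_notin; rewrite e !mem_cat !negb_or.
by move=> /andP[? _] /andP[? _] *; apply: foldl_relabel_other.
Qed.

(** The labels [i] and [i.+1] are exchanged between [c] and [c'], where only [D']
    has them crossed. *)
Lemma labelling_between x y : w2 = x ++ y ->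
  labelling D (rcons w1 c ++ x) = swap i \o labelling D' (rcons w1 c ++ x).
Proof.
move=> e; have [_ _ h3 h4 _] := word_notin; move: h3 h4; rewrite e !mem_cat !negb_or.
move=> /andP[h3 _] /andP[h4 _]; rewrite !labelling_cat foldl_relabel_other // -foldl_relabel_comp.
congr foldl; rewrite !labelling_rcons (labelling_before (y := [::])) ?cats0 //.
have [lE lS cr] := labels_c; rewrite /relabel cr {1}/replace_by_elbows eqxx /=.
rewrite (@swap_labelling _ _ _ i) //; first by apply: funext => z /=; rewrite swapK.
by right; split; [rewrite -lS | rewrite -lE]; rewrite (pipe_in_labelling D' _ ew).
Qed.

Lemma labelling_after x y : w3 = x ++ y ->
  labelling D (w1 ++ c :: w2 ++ c' :: x) = labelling D' (w1 ++ c :: w2 ++ c' :: x).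
Proof.
move=> e; have [_ _ _ _ [h3 h4]] := word_notin; move: h3 h4; rewrite e !mem_cat !negb_or.
move=> /andP[h3 _] /andP[h4 _].
have ew' : w = (rcons w1 c ++ w2) ++ c' :: w3 by rewrite ew cat_rcons -catA.
rewrite -cat_rcons catA -cat_rcons !(labelling_cat _ _ x) foldl_relabel_other //.
congr foldl; rewrite !labelling_rcons (labelling_between (y := [::])) ?cats0 //.
have [lE lS cr] := labels_c'; rewrite /relabel cr {1}/replace_by_elbows eqxx orbT /=.
rewrite (@swap_labelling _ _ _ i) //.
by left; split; [rewrite -lS | rewrite -lE]; rewrite (pipe_in_labelling D' _ ew').
Qed.

(** Outside of the pair, no comparison of pipes is affected by the exchange of
    the adjacent labels [i] and [i.+1]. *)
Lemma replace_ltE b : in_shape lam b -> b != c -> b != c' ->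
  (pipe_in k n lam D East b < pipe_in k n lam D South b)%N =
    (lab East b < lab South b)%N /\
  (pipe_in k n lam D South b < pipe_in k n lam D East b)%N =
    (lab South b < lab East b)%N.
Proof.
move=> hb /negbTE n1 /negbTE n2; have : b \in w by case: hw => _ ->.
rewrite ew mem_cat inE n1 mem_cat inE n2 /= => /or3P[] /splitPr h.
- case: h ew (labelling_before) => x y e /(_ x (b :: y) erefl) sD.
  by rewrite -catA in e; rewrite !(pipe_in_labelling _ _ e) sD.
- case: h ew (labelling_between) (no_meeting) => x y e /(_ x (b :: y) erefl) sD.
  move=> /(_ (x ++ b :: y) [::]); rewrite cats0 => /(_ erefl)[/(_ x b y erefl) nm _].
  rewrite -catA -cat_rcons catA in e.
  move: nm; rewrite /pipes !(pipe_in_labelling _ _ e) sD /= => nm.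
  by rewrite !swap_ltE // => h; apply: nm; rewrite // (perm_catC [:: _] [:: _]).
case: h ew (labelling_after) => x y e /(_ x (b :: y) erefl) sD.
have e' : w = (w1 ++ c :: w2 ++ c' :: x) ++ b :: y by rewrite e -!(catA, cat_cons).
by rewrite !(pipe_in_labelling _ _ e') sD.
Qed.

Lemma replace_lt_pair b : b = c \/ b = c' ->
  (pipe_in k n lam D East b < pipe_in k n lam D South b)%N.
Proof.
case=> ->.
  have [lE lS cr] := labels_c; move: lE lS; rewrite !(pipe_in_labelling _ _ ew) /=.
  by rewrite (labelling_before (y := [::])) ?cats0 // => -> ->.
have ew' : w = (rcons w1 c ++ w2) ++ c' :: w3 by rewrite ew cat_rcons -catA.
have [lE lS cr] := labels_c'; move: lE lS; rewrite !(pipe_in_labelling _ _ ew') /=.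
rewrite (labelling_between (y := [::])) ?cats0 //= => -> ->.
by rewrite /swap !eqxx; case: eqP; lia.
Qed.

Lemma replace_go : go_diagram k n lam D.
Proof.
move=> b hb; have [->|n1] := eqVneq b c.
  by have := replace_lt_pair (or_introl erefl); lia.
have [->|n2] := eqVneq b c'.
  by have := replace_lt_pair (or_intror erefl); lia.
rewrite replace_other // => eb; have [_ ->] := replace_ltE hb n1 n2.
exact: hD'.
Qed.

Lemma replace_symbol b : in_shape lam b -> b != c -> b != c' ->
  symbol_at k n lam D b = symbol_at k n lam D' b.
Proof.
move=> hb n1 n2; rewrite /symbol_at replace_other //.
by have [-> _] := replace_ltE hb n1 n2.
Qed.

Lemma replace_symbol_pair b : b = c \/ b = c' -> symbol_at k n lam D b = Plus.
Proof.
by rewrite /symbol_at /replace_by_elbows; case=> ->; rewrite eqxx ?orbT.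
Qed.

End Pair.

Lemma go_consistent D s1 b s2 : go_diagram k n lam D -> w = s1 ++ b :: s2 ->
  consistent (labelling D s1) (south_row b) (symbol_at k n lam D b).
Proof.
move=> go e; have := pipes_neq (D := D) e; have := go b (in_word e).
rewrite /consistent /symbol_at !(pipe_in_labelling _ _ e) /=.
case: (D b) => [|/(_ erefl)] ; last by lia.
by case: ifP => /=; lia.
Qed.

End Word.

(** Sort the cells by decreasing distance to the north-west corner. *)
Lemma reading_word_exists : exists w, reading_word lam w.
Proof.
pose s0 := undup [seq (r, c) | r <- iota 0 k, c <- iota 0 (nth 0 lam r)].
pose le (a b : cell) := (b.1 + b.2 <= a.1 + a.2)%N.
have s0m b : (b \in s0) = in_shape lam b.
  rewrite mem_undup; apply/allpairsPdep/idP => [[r [c [_ hc ->]]]|hb].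
    by move: hc; rewrite mem_iota.
  case/andP: (in_shape_lt hlam hb) => h1 h2; exists b.1, b.2.
  by rewrite !mem_iota /= add0n; split => //; case: (b).
have key a b : in_shape lam a -> in_shape lam b -> (a.1 + a.2 < b.1 + b.2)%N ->
    (index b (sort le s0) < index a (sort le s0))%N.
  move=> ha hb hab; rewrite ltnNge; apply/negP => hi.
  have tr : transitive le by move=> x y z; rewrite /le => /[swap]; exact: leq_trans.
  have rf : reflexive le by move=> x; rewrite /le.
  have so : sorted le (sort le s0) by apply: sort_sorted => x y; rewrite /le leq_total.
  have := sorted_leq_index tr rf so => /(_ a b).
  by rewrite !mem_sort !s0m => /(_ ha hb hi); rewrite /le leqNgt hab.
exists (sort le s0); split.
- by rewrite sort_uniq undup_uniq.
- by move=> b; rewrite mem_sort.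
- by move=> r c1 c2 h1 h2 lt; apply: key => //=; rewrite ltn_add2l.
- by move=> r1 r2 c h1 h2 lt; apply: key => //=; rewrite ltn_add2r.
Qed.

End Labels.

Local Open Scope ring_scope.

(** * Moving triangular matrices through one factor *)

Section Matrices.
Variables (F : numFieldType) (n : nat).
Implicit Types (f : nat -> nat) (b M : 'M[F]_n).

(** The invertible upper triangular matrices which, for each [a], preserve the span
    of the coordinate vectors [e_r] with [f r <= a]. *)
Definition parabolic f M : Prop :=
  (forall r s : 'I_n, ((s < r) || (f s < f r))%N -> M r s = 0) /\
  (forall r, M r r != 0).

Section Cell.
Variables (i : nat) (U V : 'I_n).
Hypotheses (hi : (0 < i < n)%N) (hU : U = (n - i.+1)%N :> nat) (hV : V = U.+1 :> nat).

Let UV : (U == V) = false.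
Proof. by apply/eqP => e; move: hV; rewrite -e => /n_Sn. Qed.

Lemma phiE (a b c d : F) (r s : 'I_n) : phi n i a b c d r s =
  if r == U then if s == U then a else if s == V then b else 0
  else if r == V then if s == U then c else if s == V then d else 0
  else (r == s)%:R.
Proof.
rewrite mxE -hU; have -> : (n - i = V)%N by rewrite hV hU; lia.
rewrite !(inj_eq val_inj); have [->|rU] := eqVneq r U.
  rewrite UV /=; case: ifP => // sU; case: ifP => // sV.
  by rewrite eq_sym sU.
have [->|rV] := eqVneq r V; last by [].
by rewrite /=; case: ifP => // sU; case: ifP => // sV; rewrite eq_sym sV.
Qed.

Lemma phi_mull (a b c d : F) M r s : (phi n i a b c d *m M) r s =
  if r == U then a * M U s + b * M V s
  else if r == V then c * M U s + d * M V s else M r s.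
Proof.
have VU : V != U by rewrite eq_sym UV.
rewrite mxE; have [rU|rU] := eqVneq r U; last have [rV|rV] := eqVneq r V.
- rewrite (bigD1 U) //= (bigD1 V) //= big1 => [|j /andP[/negbTE jU /negbTE jV]].
    by rewrite !phiE rU !eqxx (eq_sym V) UV addr0.
  by rewrite phiE rU eqxx jU jV mul0r.
- rewrite (bigD1 U) //= (bigD1 V) //= big1 => [|j /andP[/negbTE jU /negbTE jV]].
    by rewrite !phiE rV !eqxx (eq_sym V) UV addr0.
  by rewrite phiE rV eqxx (eq_sym V) UV jU jV mul0r.
- rewrite (bigD1 r) //= big1 => [|j jr]; rewrite phiE (negbTE rU) (negbTE rV).
    by rewrite eqxx mul1r addr0.
  by rewrite eq_sym (negbTE jr) mul0r.
Qed.

Lemma phi_mulr (a b c d : F) M r s : (M *m phi n i a b c d) r s =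
  if s == U then M r U * a + M r V * c
  else if s == V then M r U * b + M r V * d else M r s.
Proof.
have VU : V != U by rewrite eq_sym UV.
rewrite mxE; have [sU|sU] := eqVneq s U; last have [sV|sV] := eqVneq s V.
- rewrite (bigD1 U) //= (bigD1 V) //= big1 => [|j /andP[/negbTE jU /negbTE jV]].
    by rewrite !phiE sU !eqxx (eq_sym V) UV addr0.
  by rewrite phiE jU jV sU jU mulr0.
- rewrite (bigD1 U) //= (bigD1 V) //= big1 => [|j /andP[/negbTE jU /negbTE jV]].
    by rewrite !phiE sV !eqxx (eq_sym V) UV addr0.
  by rewrite phiE jU jV sV jV mulr0.
- rewrite (bigD1 s) //= big1 => [|j jr]; rewrite phiE.
    by rewrite (negbTE sU) (negbTE sV) eqxx mulr1 addr0.
  by rewrite (negbTE sU) (negbTE sV) (negbTE jr) !if_same mulr0.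
Qed.

Lemma phi_mul (a b c d a' b' c' d' : F) :
  phi n i a b c d *m phi n i a' b' c' d' =
  phi n i (a * a' + b * c') (a * b' + b * d') (c * a' + d * c') (c * b' + d * d').
Proof.
apply/matrixP => r s; rewrite phi_mull !phiE UV !eqxx (eq_sym V) UV.
have [_|rU] := eqVneq r U; last have [_|//] := eqVneq r V.
- have [_|sU] := eqVneq s U; first by [].
  by have [_|sV] := eqVneq s V; rewrite ?mulr0 ?addr0.
- have [_|sU] := eqVneq s U; first by [].
  by have [_|sV] := eqVneq s V; rewrite ?mulr0 ?addr0.
Qed.

Lemma phi1 : phi n i 1 0 0 1 = 1%:M :> 'M[F]_n.
Proof.
apply/matrixP => r s; rewrite phiE mxE.
have [->|rU] := eqVneq r U; last have [->|rV //] := eqVneq r V.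
  by rewrite (eq_sym U s); case: ifP => // _; case: ifP.
rewrite (eq_sym V s); case: ifP => [/eqP ->|_]; first by rewrite UV.
by case: ifP.
Qed.

Lemma invmx_sdot : invmx (sdot F n i) = phi n i 0 1 (-1) 0.
Proof.
have e : phi n i 0 1 (-1) 0 *m sdot F n i = 1%:M.
  by rewrite phi_mul -phi1; congr phi; ring.
have [_ u] := mulmx1_unit e; have := mulmxV u.
by move=> e2; rewrite -[LHS]mul1mx -e -mulmxA e2 mulmx1.
Qed.

(** The product [b *m y_ n i p] has only one entry below the diagonal, at
    [(V, U)]. As [b U V = 0], its entry at [(U, U)] is still [b U U], which gives
    the [p'] that clears the former. Entries between
    rows of equal [f] stay, since the row operation and the column operation add
    to them only multiples of entries of [b] that [f] forces to be zero. *)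
Lemma push_y f b (p : F) : parabolic f b -> (f V < f U)%N ->
  exists p' b', [/\ p' = p * (b V V / b U U), b *m y_ n i p = y_ n i p' *m b',
    parabolic f b' & forall r s : 'I_n, f r = f s -> b' r s = b r s].
Proof.
move=> [z d] hf; set p' := _ * _; exists p', (y_ n i (- p') *m b *m y_ n i p).
have bUV : b U V = 0 by apply: z; rewrite hf orbT.
have bVU : b V U = 0 by apply: z; rewrite hV ltnSn.
have E r s : (y_ n i (- p') *m b *m y_ n i p) r s = b r s +
   (if s == U then p * b r V else 0) - (if r == V then p' * b U s else 0).
  rewrite phi_mulr !phi_mull.
  have [->|rU] := eqVneq r U; first rewrite UV.
    have [->|sU] := eqVneq s U; first by rewrite bUV; ring.
    by have [->|sV] := eqVneq s V; rewrite ?bUV; ring.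
  have [->|rV] := eqVneq r V.
    have [->|sU] := eqVneq s U; first by rewrite bUV; ring.
    by have [->|sV] := eqVneq s V; rewrite ?bUV; ring.
  have [->|sU] := eqVneq s U; first by ring.
  by have [->|sV] := eqVneq s V; ring.
have B (r s : 'I_n) : f r = f s -> (y_ n i (- p') *m b *m y_ n i p) r s = b r s.
  move=> e; rewrite E; case: eqP => [sU|_]; case: eqP => [rV|_]; rewrite ?addr0 ?subr0 //.
  - by move: e hf; rewrite sU rV => ->; rewrite ltnn.
  - by rewrite (z r V) ?mulr0 ?addr0 // e sU hf orbT.
  - by rewrite (z U s) ?mulr0 ?subr0 // -e rV hf orbT.
split => //.
  by rewrite !mulmxA phi_mul -[LHS]mul1mx -phi1 !mulmxA; congr (phi _ _ _ _ _ _ *m _ *m _); ring.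
split=> [r s h|r]; last by rewrite B.
rewrite E; case: eqP => [sU|sU]; case: eqP => [rV|rV]; rewrite ?addr0 ?subr0.
- by rewrite sU rV bVU /p'; field; apply: d.
- rewrite (z r s h) (z r V) ?mulr0 ?addr0 //; move: h; rewrite sU => /orP[h|h].
    have : r <> V :> nat by move/val_inj.
    by move: h hV; lia.
  by rewrite (ltn_trans hf h) orbT.
- rewrite (z r s h) (z U s) ?mulr0 ?subr0 //; move: h; rewrite rV => /orP[h|h].
    have : s <> U :> nat by move/val_inj.
    by move: h hV; lia.
  by rewrite (ltn_trans h hf) orbT.
- exact: z.
Qed.

(** Here [p'] is chosen such that the entry at [(U, V)] is cleared, which the
    permutation in the factor of a black stone would move below the diagonal. *)
Lemma push_x f b (p : F) : parabolic f b -> (f U < f V)%N ->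
  exists p' b', [/\ b *m x_ n i p = x_ n i p' *m b', b' U V = 0,
    parabolic f b' & forall r s : 'I_n, f r = f s -> b' r s = b r s].
Proof.
move=> [z d] hf; set p' := (b U V + p * b U U) / b V V.
exists p', (x_ n i (- p') *m b *m x_ n i p).
have bVU : b V U = 0 by apply: z; rewrite hV ltnSn.
have E r s : (x_ n i (- p') *m b *m x_ n i p) r s = b r s +
   (if s == V then p * b r U else 0) -
   (if r == U then p' * (b V s + (if s == V then p * b V U else 0)) else 0).
  rewrite phi_mulr !phi_mull.
  have [->|rU] := eqVneq r U.
    have [->|sU] := eqVneq s U; first by rewrite UV bVU; ring.
    by have [->|sV] := eqVneq s V; rewrite ?bVU; ring.
  have [->|rV] := eqVneq r V.
    have [->|sU] := eqVneq s U; first by rewrite UV bVU; ring.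
    by have [->|sV] := eqVneq s V; rewrite ?bVU; ring.
  have [->|sU] := eqVneq s U; first by rewrite UV; ring.
  by have [->|sV] := eqVneq s V; ring.
have {}E r s : (x_ n i (- p') *m b *m x_ n i p) r s = b r s +
   (if s == V then p * b r U else 0) - (if r == U then p' * b V s else 0).
  by rewrite E bVU mulr0 if_same addr0.
have B (r s : 'I_n) : f r = f s -> (x_ n i (- p') *m b *m x_ n i p) r s = b r s.
  move=> e; rewrite E; case: eqP => [sV|_]; case: eqP => [rU|_]; rewrite ?addr0 ?subr0 //.
  - by move: e hf; rewrite sV rU => ->; rewrite ltnn.
  - by rewrite (z r U) ?mulr0 ?addr0 // e sV hf orbT.
  - by rewrite (z V s) ?mulr0 ?subr0 // -e rU hf orbT.
split => //.
- by rewrite !mulmxA phi_mul -[LHS]mul1mx -phi1 !mulmxA; congr (phi _ _ _ _ _ _ *m _ *m _); ring.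
- by rewrite E !eqxx /p'; field; apply: d.
split=> [r s h|r]; last by rewrite B.
rewrite E; case: eqP => [sV|sV]; case: eqP => [rU|rU]; rewrite ?addr0 ?subr0.
- by move: h; rewrite sV rU hV ltnNge leqnSn /= -hV ltnNge (ltnW hf).
- rewrite (z r s h) (z r U) ?mulr0 ?addr0 //; move: h; rewrite sV => /orP[h|h].
    by move: h hV; lia.
  by rewrite (ltn_trans hf h) orbT.
- rewrite (z r s h) (z V s) ?mulr0 ?subr0 //; move: h; rewrite rU => /orP[h|h].
    by move: h hV; lia.
  by rewrite (ltn_trans h hf) orbT.
- exact: z.
Qed.

Lemma tperm_swap (r : 'I_n) : tperm U V r = swap U r :> nat.
Proof.
rewrite /swap -hV !(inj_eq val_inj); case: tpermP => [->|->|/eqP/negbTE -> /eqP/negbTE ->] //.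
  by rewrite eqxx.
by rewrite (eq_sym V) UV eqxx.
Qed.

(** The sign [e] covers both [sdot] and its inverse. *)
Lemma push_sdot f b (e : F) : parabolic f b -> b U V = 0 -> e ^+ 2 = 1 ->
  exists b', [/\ b *m phi n i 0 (- e) e 0 = phi n i 0 (- e) e 0 *m b',
    parabolic (f \o swap U) b',
    forall r, b' r r = b (tperm U V r) (tperm U V r) &
    forall r s, b' r s ^+ 2 = b (tperm U V r) (tperm U V s) ^+ 2].
Proof.
move=> [z d] bUV e2; exists (phi n i 0 e (- e) 0 *m b *m phi n i 0 (- e) e 0).
have E r s : (phi n i 0 e (- e) 0 *m b *m phi n i 0 (- e) e 0) r s =
   (if r == U then e else if r == V then - e else 1) *
   (if s == U then e else if s == V then - e else 1) *
   b (tperm U V r) (tperm U V s).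
  rewrite phi_mulr !phi_mull.
  have [->|rU] := eqVneq r U.
    rewrite tpermL.
    have [->|sU] := eqVneq s U; first by rewrite tpermL; ring.
    have [->|sV] := eqVneq s V; first by rewrite tpermR; ring.
    by rewrite tpermD 1?eq_sym //; ring.
  have [->|rV] := eqVneq r V.
    rewrite tpermR.
    have [->|sU] := eqVneq s U; first by rewrite tpermL; ring.
    have [->|sV] := eqVneq s V; first by rewrite tpermR; ring.
    by rewrite tpermD 1?eq_sym //; ring.
  rewrite (tpermD (z := r)) 1?eq_sym //.
  have [->|sU] := eqVneq s U; first by rewrite tpermL; ring.
  have [->|sV] := eqVneq s V; first by rewrite tpermR; ring.
  by rewrite tpermD 1?eq_sym //; ring.
have G r : (if r == U then e else if r == V then - e else 1) ^+ 2 = 1.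
  by case: ifP => _; [|case: ifP => _]; rewrite ?sqrrN ?expr1n.
have D r : (phi n i 0 e (- e) 0 *m b *m phi n i 0 (- e) e 0) r r =
    b (tperm U V r) (tperm U V r).
  by rewrite E -expr2 G mul1r.
split=> //.
- rewrite !mulmxA phi_mul -[LHS]mul1mx -phi1 -[1]e2 !mulmxA.
  by congr (phi _ _ _ _ _ _ *m _ *m _); ring.
- split=> [r s h|r]; last by rewrite D.
  rewrite E; have [/andP[/eqP -> /eqP ->]|h2] := boolP ((r == V) && (s == U)).
    by rewrite tpermL tpermR bUV mulr0.
  rewrite z ?mulr0 // !tperm_swap; case/orP: h => [h|-> /=]; last by rewrite orbT.
  rewrite [X in (X || _)](_ : _ = true) //; apply: swap_lt (h) _ => [[es er]].
  by move/negP: h2; apply; rewrite -!(inj_eq val_inj) /= es er hV !eqxx.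
- by move=> r s; rewrite E !exprMn !G !mul1r.
Qed.

End Cell.
End Matrices.

(** * Moving triangular matrices through a word *)

(** The index and the symbol of a cell. *)
Definition letter : Type := nat * symbol.

(** The labels of the two pipes of the pair become equal, so that no condition is
    put on the labels of an entry between them in [parabolic (glue i \o sg)]. *)
Definition glue (i x : nat) : nat := if x == i.+1 then i else x.

Section Words.
Variables (F : numFieldType) (n : nat).
Implicit Types (f sg kap : nat -> nat) (b M : 'M[F]_n) (l : letter) (ls : seq letter).

Definition turn sg l : nat -> nat :=
  if l.2 is Plus then sg else sg \o swap (n - l.1.+1).

Definition letter_mx l (p : F) : 'M[F]_n :=
  match l.2 with
  | Black => x_ n l.1 p *m invmx (sdot F n l.1)
  | Plus => y_ n l.1 p
  | White => sdot F n l.1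
  end.

Definition allowed l (p : F) : Prop := l.2 = Plus -> p != 0.

(** The set of products [G_] in terms of letters; each letter has a parameter of
    its own, which allows to change parameters letter by letter. *)
Fixpoint word_mx ls (M : 'M[F]_n) : Prop :=
  if ls is l :: ls' then
    exists p M', [/\ allowed l p, word_mx ls' M' & M = letter_mx l p *m M']
  else M = 1%:M.

Fixpoint admissible kap sg ls : Prop :=
  if ls is l :: ls' then
    [/\ (0 < l.1 < n)%N, consistent (kap \o sg) (n - l.1.+1) l.2 &
      admissible kap (turn sg l) ls']
  else True.

(** The diagonal block of [b] at the rows labelled [x] and [y]. Its off-diagonal
    entry changes sign under conjugation by [sdot], so only its square is kept. *)
Definition corner (x y : nat) (dx dy e : F) sg b : Prop :=
  forall r s : 'I_n, sg r = x -> sg s = y ->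
    [/\ b r r = dx, b s s = dy & b r s ^+ 2 = e].

Section Cell.
Variable i : nat.
Hypothesis hi : (0 < i < n)%N.

Lemma rows_of_cell : exists U V : 'I_n,
  U = (n - i.+1)%N :> nat /\ V = U.+1 :> nat.
Proof.
have h1 : (n - i.+1 < n)%N by lia.
have h2 : ((n - i.+1).+1 < n)%N by lia.
by exists (Ordinal h1), (Ordinal h2).
Qed.

Lemma corner_block kap x y dx dy e sg b b' : kap x = kap y ->
  (forall r s : 'I_n, (kap \o sg) r = (kap \o sg) s -> b' r s = b r s) ->
  corner x y dx dy e sg b -> corner x y dx dy e sg b'.
Proof.
move=> kxy E h r s sr ss; have [h1 h2 h3] := h r s sr ss.
by split; rewrite E //= sr ss.
Qed.

Lemma corner_swap (U V : 'I_n) x y dx dy e sg b b' :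
  V = U.+1 :> nat ->
  (forall r, b' r r = b (tperm U V r) (tperm U V r)) ->
  (forall r s, b' r s ^+ 2 = b (tperm U V r) (tperm U V s) ^+ 2) ->
  corner x y dx dy e sg b -> corner x y dx dy e (sg \o swap U) b'.
Proof.
move=> hV D E h r s /=; rewrite -!(tperm_swap hV) => sr ss.
by rewrite !D E; apply: h.
Qed.

Lemma push_letter kap sg (sy : symbol) b (p : F) :
  consistent (kap \o sg) (n - i.+1) sy -> parabolic (kap \o sg) b ->
  allowed (i, sy) p ->
  exists p' b', [/\ allowed (i, sy) p',
    b *m letter_mx (i, sy) p = letter_mx (i, sy) p' *m b',
    parabolic (kap \o turn sg (i, sy)) b' &
    forall x y dx dy e, kap x = kap y -> corner x y dx dy e sg b ->
      corner x y dx dy e (turn sg (i, sy)) b'].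
Proof.
have [U [V [hU hV]]] := rows_of_cell.
rewrite /letter_mx /turn /consistent /allowed -hU -hV; case: sy => /= hf pb hp.
- have [p' [b' [ep e pb' eb]]] := push_y hi hU hV p pb hf; exists p', b'; split=> //.
    by move=> _; rewrite ep mulf_neq0 ?hp // mulf_neq0 ?invr_eq0 //; apply: pb.2.
  by move=> x y dx dy c kxy; apply: (corner_block kxy).
- have bUV : b U V = 0 by apply: pb.1; rewrite /= hf orbT.
  have [b' [e pb' D E]] := push_sdot hi hU hV pb bUV (expr1n F 2).
  by exists p, b'; split=> // x y dx dy c _; apply: (corner_swap hV).
have [p' [b1 [e1 b1UV pb1 eb]]] := push_x hi hU hV p pb hf.
have e2 : (-1) ^+ 2 = 1 :> F by rewrite sqrrN expr1n.
have [b' [e pb' D E]] := push_sdot hi hU hV pb1 b1UV e2.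
rewrite opprK in e; exists p', b'; split=> //.
  by rewrite (invmx_sdot _ hi hU hV) mulmxA e1 -mulmxA e mulmxA.
move=> x y dx dy c kxy h; apply: (corner_swap hV D E).
exact: (corner_block kxy eb).
Qed.

End Cell.

(** The map [kap] is [glue i] between [c] and [c'] and the identity after [c']. *)
Lemma push_word kap sg ls b M :
  admissible kap sg ls -> parabolic (kap \o sg) b -> word_mx ls M ->
  exists M' b', [/\ word_mx ls M', b *m M = M' *m b',
    parabolic (kap \o foldl turn sg ls) b' &
    forall x y dx dy e, kap x = kap y -> corner x y dx dy e sg b ->
      corner x y dx dy e (foldl turn sg ls) b'].
Proof.
elim: ls sg b M => [|[i sy] ls IH] sg b M /=.
  by move=> _ pb ->; exists 1%:M, b; rewrite mulmx1 mul1mx.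
case=> hi hs ha pb [p [M1 [hp hM1 ->]]].
have [p' [b1 [hp' e1 pb1 c1]]] := push_letter hi hs pb hp.
have [M2 [b2 [hM2 e2 pb2 c2]]] := IH _ _ _ ha pb1 hM1.
exists (letter_mx (i, sy) p' *m M2), b2; split=> //.
- by exists p', M2.
- by rewrite mulmxA e1 -mulmxA e2 mulmxA.
by move=> x y dx dy e kxy /(c1 _ _ _ _ _ kxy)/(c2 _ _ _ _ _ kxy).
Qed.

Section Pair.
Variables (l : nat) (sg : nat -> nat).
Hypotheses (l_gt0 : (0 < l)%N)
  (inj_sg : forall x y, sg x = sg y -> (0 < sg x)%N -> x = y).

(** In the rows of the cell, in [SL_2],
    [(t, -1; 1, 0) = (1, 0; 1 / t, 1) * (t, -1; 0, 1 / t)]. *)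
Lemma cross i (U V : 'I_n) (t : F) : (0 < i < n)%N ->
  U = (n - i.+1)%N :> nat -> V = U.+1 :> nat ->
  sg U = l.+1 -> sg V = l -> t != 0 ->
  exists b, [/\ x_ n i t *m sdot F n i = y_ n i t^-1 *m b,
    parabolic (glue l \o (sg \o swap U)) b &
    corner l l.+1 t t^-1 1 (sg \o swap U) b].
Proof.
move=> hi hU hV sU sV t0; exists (phi n i t (-1) 0 t^-1).
have UV : (U == V) = false by apply/eqP => e; move: hV; rewrite -e => /n_Sn.
have swU : swap U U = V by rewrite /swap eqxx hV.
have swV : swap U V = U.
  by rewrite /swap -hV (inj_eq val_inj) (eq_sym V) UV eqxx.
have E := phiE hi hU hV; split.
- by rewrite !(phi_mul hi hU hV); congr phi; field.
- split=> [r s|r]; rewrite E.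
    have [->|rU] := eqVneq r U.
      have [->|sU'] := eqVneq s U; first by rewrite !ltnn.
      have [->|//] := eqVneq s V.
      by rewrite hV ltnNge leqnSn /= -hV swU swV sU sV /glue; repeat case: ifP; lia.
    have [->|rV] := eqVneq r V.
      have [//|sU'] := eqVneq s U.
      by have [->|//] := eqVneq s V; rewrite !ltnn.
    by have [->|//] := eqVneq r s; rewrite !ltnn.
  have [//|rU] := eqVneq r U.
  by have [_|rV] := eqVneq r V; rewrite ?eqxx ?invr_eq0 ?oner_eq0.
move=> r s /= sr ss.
have rU : r = U.
  apply: val_inj; apply: (can_inj (@swapK U)); rewrite swU; apply: inj_sg; by rewrite sr ?sV.
have sV' : s = V.
  by apply: val_inj; apply: (can_inj (@swapK U)); rewrite swV; apply: inj_sg; rewrite ss ?sU.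
by rewrite rU sV' !E UV !eqxx (eq_sym V) UV sqrrN expr1n.
Qed.

(** The column operation of a black stone moves the entry [b U V] to the diagonal,
    where it serves as the pivot for an elbow on the left. The factor [x_ n i _]
    clears the entry at [(U, V)] of the result, which the cells after the
    uncrossing need, since the two pipes may meet again there. *)
Lemma uncross i (U V : 'I_n) b (t q : F) : (0 < i < n)%N ->
  U = (n - i.+1)%N :> nat -> V = U.+1 :> nat ->
  sg U = l -> sg V = l.+1 -> t != 0 ->
  parabolic (glue l \o sg) b -> b U U = t -> b V V = t^-1 ->
  t * q + b U V != 0 ->
  exists s b', [/\ s != 0,
    b *m (x_ n i q *m invmx (sdot F n i) *m x_ n i (t / (t * q + b U V))) =
      y_ n i s *m b' & parabolic (sg \o swap U) b'].
Proof.
move=> hi hU hV sU sV t0 [z d] bUU bVV; set e := b U V; set Z := t * q + e => Z0.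
have UV : (U == V) = false by apply/eqP => h; move: hV; rewrite -h => /n_Sn.
have swU : swap U U = V by rewrite /swap eqxx hV.
have swV : swap U V = U.
  by rewrite /swap -hV (inj_eq val_inj) (eq_sym V) UV eqxx.
have sw r : r != U -> r != V -> swap U r = r.
  by rewrite /swap -hV !(inj_eq val_inj) => /negbTE -> /negbTE ->.
have ms (r : 'I_n) : r != U -> r != V -> sg r != l /\ sg r != l.+1.
  move=> rU rV; split; apply/eqP => h.
    by move/eqP: rU; apply; apply: val_inj; apply: inj_sg; rewrite h ?sU.
  by move/eqP: rV; apply; apply: val_inj; apply: inj_sg; rewrite h ?sV.
have bVU : b V U = 0 by apply: z; rewrite hV ltnSn.
pose s0 := (t * Z)^-1; exists s0.
pose N := x_ n i q *m invmx (sdot F n i) *m x_ n i (t / Z).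
have NE : N = phi n i (- q) (1 - q * (t / Z)) (-1) (- (t / Z)).
  by rewrite /N (invmx_sdot _ hi hU hV) !(phi_mul hi hU hV); congr phi; ring.
exists (y_ n i (- s0) *m (b *m N)).
have E r s : (y_ n i (- s0) *m (b *m N)) r s =
    (if s == U then - q * b r U - b r V else
     if s == V then (1 - q * (t / Z)) * b r U - (t / Z) * b r V else b r s) -
    (if r == V then s0 * (if s == U then - q * t - e else
     if s == V then 0 else b U s) else 0).
  rewrite (phi_mull hi hU hV) NE !(phi_mulr hi hU hV).
  have ez : (1 - q * (t / Z)) * t - t / Z * e = 0 by rewrite /Z; field.
  have [->|rU] := eqVneq r U.
    by rewrite UV; case: ifP => _; [|case: ifP => _]; ring.
  have [->|rV] := eqVneq r V.
    case: ifP => _; first by rewrite bUU /e; ring.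
    case: ifP => _; last by ring.
    by rewrite bUU -/e -[in RHS]ez; ring.
  by case: ifP => _; [|case: ifP => _]; ring.
split; first by rewrite invr_eq0 mulf_neq0.
  rewrite [RHS]mulmxA (phi_mul hi hU hV) -[LHS]mul1mx -(phi1 F hi hU hV).
  by congr (phi _ _ _ _ _ _ *m _); ring.
have mlV : glue l l.+1 = l by rewrite /glue eqxx.
have mlU : glue l l = l by rewrite /glue; case: ifP; lia.
have mr (r : 'I_n) : r != U -> r != V -> glue l (sg r) = sg r.
  by move=> rU rV; have [_ /negbTE h] := ms r rU rV; rewrite /glue h.
split=> [r s|r]; rewrite E.
  have [->|rU] := eqVneq r U.
    rewrite UV subr0; have [->|sU'] := eqVneq s U; first by rewrite !ltnn.
    have [->|sV'] := eqVneq s V.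
      by move=> _; rewrite bUU -/e /Z; field.
    rewrite /= swU (sw s) // sV => h; apply: z; move: h.
    case/orP => [->//|h]; apply/orP; right; rewrite /= mr // sU mlU.
    by have [/eqP] := ms s sU' sV'; move: h; lia.
  have [->|rV] := eqVneq r V.
    have [->|sU'] := eqVneq s U.
      by move=> _; rewrite bVU bVV /s0 /Z; field; rewrite t0 Z0.
    have [->|sV'] := eqVneq s V; first by rewrite !ltnn.
    rewrite /= swV (sw s) // sU => h.
    have sU2 : s <> U :> nat by move/val_inj/eqP; rewrite (negbTE sU').
    rewrite (z V s) ?(z U s) ?mulr0 ?subr0 //=; apply/orP; rewrite mr // ?sU ?sV ?mlU ?mlV.
      by case/orP: h => h; [left | right]; lia.
    by case/orP: h => h; [left | right]; lia.
  have [r1 r2] := ms r rU rV; rewrite subr0.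
  have rV2 : r <> V :> nat by move/val_inj/eqP; rewrite (negbTE rV).
  have [->|sU'] := eqVneq s U.
    rewrite /= swU (sw r) // sV => h.
    rewrite (z r U) ?(z r V) ?mulr0 ?subr0 //=; apply/orP; rewrite (mr r rU rV) ?sU ?sV ?mlU ?mlV;
      by case/orP: h => h; [left | right]; lia.
  have [->|sV'] := eqVneq s V.
    rewrite /= swV (sw r) // sU => h.
    rewrite (z r U) ?(z r V) ?mulr0 ?subr0 //=; apply/orP; rewrite (mr r rU rV) ?sU ?sV ?mlU ?mlV;
      by case/orP: h => h; [left | right]; lia.
  by rewrite /= !sw // => h; apply: z; rewrite /= !mr.
have [->|rU] := eqVneq r U.
  by rewrite UV subr0 bUU -/e -oppr_eq0; move: Z0; rewrite /Z; congr (_ != 0); ring.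
have [->|rV] := eqVneq r V.
  rewrite bVU bVV !mulr0 subr0 sub0r oppr_eq0.
  by rewrite !mulf_neq0 ?invr_eq0.
by rewrite subr0; apply: d.
Qed.

End Pair.
End Words.

Section Deformation.
Variables (F : numFieldType) (n : nat).
Implicit Types (b M : 'M[F]_n) (ls : seq letter).

Lemma word_mx_cat ls1 ls2 M : word_mx (ls1 ++ ls2) M <->
  exists M1 M2, [/\ word_mx ls1 M1, word_mx ls2 M2 & M = M1 *m M2].
Proof.
elim: ls1 M => [|l ls1 IH] M /=.
  split=> [h|[M1 [M2 [-> h ->]]]]; last by rewrite mul1mx.
  by exists 1%:M, M; rewrite mul1mx.
split=> [[p [M' [hp /IH[M1 [M2 [h1 h2 ->]]] ->]]]|[M1 [M2 [[p [M' [hp h1 ->]]] h2 ->]]]].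
  by exists (letter_mx n l p *m M1), M2; rewrite mulmxA; split=> //; exists p, M1.
exists p, (M' *m M2); rewrite mulmxA; split=> //; apply/IH.
by exists M', M2.
Qed.

Lemma x_unit i (p : F) : (0 < i < n)%N -> x_ n i p \in unitmx.
Proof.
move=> hi; have [U [V [hU hV]]] := rows_of_cell hi.
have e : x_ n i p *m x_ n i (- p) = 1%:M.
  by rewrite (phi_mul hi hU hV) -(phi1 F hi hU hV); congr phi; ring.
by have [] := mulmx1_unit e.
Qed.

Lemma letter_unit l (p : F) : (0 < l.1 < n)%N -> letter_mx n l p \in unitmx.
Proof.
case: l => i sy /= hi; have [U [V [hU hV]]] := rows_of_cell hi.
have su : sdot F n i \in unitmx.
  have e : sdot F n i *m phi n i 0 1 (-1) 0 = 1%:M.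
    by rewrite (phi_mul hi hU hV) -(phi1 F hi hU hV); congr phi; ring.
  by have [] := mulmx1_unit e.
rewrite /letter_mx; case: sy => //=.
  have e : y_ n i p *m y_ n i (- p) = 1%:M.
    by rewrite (phi_mul hi hU hV) -(phi1 F hi hU hV); congr phi; ring.
  by have [] := mulmx1_unit e.
by rewrite unitmx_mul x_unit // unitmx_inv.
Qed.

Lemma word_unit ls M : all (fun l => 0 < l.1 < n)%N ls -> word_mx ls M ->
  M \in unitmx.
Proof.
elim: ls M => [|l ls IH] M /= => [_ ->|/andP[hl hs] [p [M' [_ h ->]]]].
  exact: unitmx1.
by rewrite unitmx_mul letter_unit // IH.
Qed.

Lemma x_affine i : (0 < i < n)%N ->
  exists E : 'M[F]_n, forall p, x_ n i p = 1%:M + p *: E.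
Proof.
move=> hi; have [U [V [hU hV]]] := rows_of_cell hi; exists (delta_mx U V) => p.
have UV : (U == V) = false by apply/eqP => h; move: hV; rewrite -h => /n_Sn.
apply/matrixP => r s; rewrite (phiE hi hU hV) !mxE.
have [->|rU] := eqVneq r U.
  rewrite (eq_sym U s); have [->|sU] := eqVneq s U; first by rewrite UV mulr0 addr0.
  by case: ifP; rewrite add0r ?mulr1 ?mulr0.
rewrite mulr0 addr0; have [->|rV //] := eqVneq r V.
rewrite (eq_sym V s); have [->|sU] := eqVneq s U; first by rewrite UV.
by case: ifP.
Qed.

Lemma sqr1_shift_neq0 (a e : F) : e ^+ 2 = 1 -> `|a| < 1 -> a + e != 0.
Proof.
move=> e2 a1; rewrite addr_eq0; apply/eqP => ae.
have : `|a| ^+ 2 = 1 by rewrite -normrX ae sqrrN e2 normr1.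
by move/eqP; rewrite sqrp_eq1 // => /eqP a1'; rewrite a1' ltxx in a1.
Qed.

(** The error starts at the crossing [i1], with the labels [l] and [l.+1] glued
    along [Q], and is free of the exceptional entry along [T]. The sign of [e]
    may depend on [t]. *)
Lemma deform l (sg : nat -> nat) i1 i2 (Q T : seq letter) (MQ MT : 'M[F]_n)
    (t q : F) :
  let sg1 := turn n sg (i1, White) in
  let sg2 := foldl (turn n) sg1 Q in
  let sg3 := turn n sg2 (i2, Black) in
  (0 < i1 < n)%N -> (0 < i2 < n)%N -> (0 < l)%N ->
  (forall x y, sg x = sg y -> (0 < sg x)%N -> x = y) ->
  (forall x y, sg2 x = sg2 y -> (0 < sg2 x)%N -> x = y) ->
  sg (n - i1.+1)%N = l.+1 -> sg (n - i1.+1).+1%N = l ->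
  sg2 (n - i2.+1)%N = l -> sg2 (n - i2.+1).+1%N = l.+1 ->
  admissible n (glue l) sg1 Q -> admissible n id sg3 T ->
  word_mx Q MQ -> word_mx T MT -> t != 0 -> `|t * q| < 1 ->
  exists e M b, [/\ e ^+ 2 = 1,
    word_mx ((i1, Plus) :: Q ++ (i2, Plus) :: T) M,
    parabolic (foldl (turn n) sg3 T) b &
    x_ n i1 t *m sdot F n i1 *m MQ *m
      (x_ n i2 q *m invmx (sdot F n i2) *m x_ n i2 (t / (t * q + e))) *m MT =
    M *m b].
Proof.
move=> sg1 sg2 sg3 hi1 hi2 l0 inj1 inj2 a1 a2 a3 a4 adQ adT wQ wT t0 tq.
have [U1 [V1 [hU1 hV1]]] := rows_of_cell hi1.
have [U2 [V2 [hU2 hV2]]] := rows_of_cell hi2.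
rewrite -hU1 -hV1 in a1 a2; rewrite -hU2 -hV2 in a3 a4.
have [b0 [e0 p0 c0]] := cross l0 inj1 hi1 hU1 hV1 a1 a2 t0.
have esg1 : sg \o swap U1 = sg1 by rewrite /sg1 /turn /= hU1.
rewrite esg1 in p0 c0.
have [MQ' [b1 [wQ' e1 p1 c1]]] := push_word adQ p0 wQ.
have mll : glue l l = glue l l.+1 by rewrite /glue eqxx; case: ifP.
have [bUU bVV bUV] := c1 _ _ _ _ _ mll c0 U2 V2 a3 a4.
have Z0 : t * q + b1 U2 V2 != 0 by apply: sqr1_shift_neq0.
have [s [b2 [s0 e2 p2]]] := uncross l0 inj2 hi2 hU2 hV2 a3 a4 t0 p1 bUU bVV Z0.
have esg3 : sg2 \o swap U2 = sg3 by rewrite /sg3 /turn /= hU2.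
rewrite esg3 in p2.
have [MT' [b3 [wT' e3 p3 _]]] := push_word (kap := id) adT p2 wT.
exists (b1 U2 V2), (y_ n i1 t^-1 *m MQ' *m y_ n i2 s *m MT'), b3; split=> //.
  exists t^-1, (MQ' *m (y_ n i2 s *m MT')); split; last by rewrite !mulmxA.
    by move=> _; rewrite invr_eq0.
  apply/word_mx_cat; exists MQ', (y_ n i2 s *m MT'); split=> //.
  by exists s, MT'; split=> // _.
set X := x_ n i2 q *m _ *m _ in e2 *; rewrite e0.
transitivity (y_ n i1 t^-1 *m (b0 *m MQ) *m X *m MT); first by rewrite !mulmxA.
rewrite e1; transitivity (y_ n i1 t^-1 *m MQ' *m (b1 *m X) *m MT).
  by rewrite !mulmxA.
rewrite e2; transitivity (y_ n i1 t^-1 *m MQ' *m y_ n i2 s *m (b2 *m MT)).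
  by rewrite !mulmxA.
by rewrite e3 !mulmxA.
Qed.

End Deformation.

Local Open Scope classical_set_scope.

(** * Approximation in the Grassmannian *)

Section Spans.
Variables (F : numFieldType) (k n : nat) (hkn : (k <= n)%N).

Lemma unit_frame (g : 'M[F]_n) : g \in unitmx -> frames (bottom_up_mx hkn g).
Proof.
move=> gu; rewrite /frames /=.
have -> : [seq row r (bottom_up_mx hkn g) | r <- enum 'I_k] =
    [tuple row r (bottom_up_mx hkn g) | r < k] by rewrite /= -val_ord_tuple.
apply/freeP => a; under eq_bigr do rewrite -tnth_nth tnth_mktuple.
move=> ha i0; pose v : 'cV[F]_n := \sum_i a i *: delta_mx (widen_ord hkn i) 0.
have gv : g *m v = 0.
  apply/matrixP => j z; rewrite mulmx_sumr summxE mxE.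
  move/rowP/(_ (rev_ord j)): ha; rewrite summxE [RHS]mxE => h; rewrite -[RHS]h ord1.
  by apply: eq_bigr => i _; rewrite -scalemxAr -colE !mxE rev_ordK.
have : v = 0 by rewrite -(mulKmx gu v) gv mulmx0.
move/matrixP/(_ (widen_ord hkn i0) 0); rewrite summxE mxE (bigD1 i0) //= big1 => [|i ii0].
  by rewrite !mxE !eqxx mulr1 addr0.
by rewrite !mxE -(inj_eq val_inj) /= (inj_eq val_inj) eq_sym (negbTE ii0) mulr0.
Qed.

Definition frame_of (A : 'M[F]_(k, n)) (fr : frames A) : @frames F k n :=
  exist (fun A => A \in @frames F k n) A (mem_set fr).

(** Column [r] of [g *m b] is a combination of the columns of [g] up to [r]. *)
Lemma row_span_mul (g b : 'M[F]_n) f : parabolic f b -> g *m b \in unitmx ->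
  row_span (bottom_up_mx hkn (g *m b)) = row_span (bottom_up_mx hkn g).
Proof.
move=> [z _] /unit_frame fr; apply/eqP; rewrite eqEdim; apply/andP; split.
  apply/span_subvP => v /mapP[r _ ->].
  have -> : row r (bottom_up_mx hkn (g *m b)) =
      \sum_(s < k) b (widen_ord hkn s) (widen_ord hkn r) *: row s (bottom_up_mx hkn g).
    apply/rowP => j; rewrite summxE !mxE (bigID (fun s : 'I_n => s < k)%N) /=.
    rewrite [X in _ + X]big1 => [|s ks]; last first.
      by rewrite z ?mulr0 //= (leq_trans (ltn_ord r)) // leqNgt.
    rewrite addr0 (big_ord_narrow hkn); apply: eq_bigr => s _.
    by rewrite !mxE mulrC.
  apply: memv_suml => s _; apply: memvZ; apply: memv_span.
  by apply: map_f; rewrite mem_enum.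
have /eqP -> := dim_row_span (frame_of fr).
by apply: leq_trans (dim_span _) _; rewrite size_map size_enum_ord.
Qed.

(** The map from frames to the Grassmannian is continuous, so it suffices to
    approximate a frame. *)
Lemma closure_Gr (S : set (Gr F k n)) (A0 : @frames F k n) :
  (forall e : F, 0 < e -> exists A : @frames F k n,
     S (Gr_of_frame A) /\ forall i j, `|val A i j - val A0 i j| < e) ->
  closure S (Gr_of_frame A0).
Proof.
move=> h B; rewrite nbhsE => -[U [oU UA] UB].
have [O oO OE] : open (@Gr_of_frame F k n @^-1` U) by exact: oU.
have OA : O (val A0) by have := UA; rewrite -[U _]/((_ @^-1` U) A0) -OE.
have : nbhs (val A0) O by apply: open_nbhs_nbhs.
case/nbhs_ballP => e /= e0 he; have [A [SA hA]] := h e e0.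
exists (Gr_of_frame A); split => //; apply: UB.
rewrite -[U _]/((_ @^-1` U) A) -OE; apply: he; split=> // i j.
by rewrite /ball /= distrC.
Qed.

(** The estimate is uniform in [e], so [t] can be chosen before the sign of [e] is
    known. *)
Lemma small_deformation (A1 A2 A3 : 'M[F]_(k, n)) (q d : F) : 0 < d ->
  exists t : F, [/\ t != 0, `|t * q| < 1 &
    forall e, e ^+ 2 = 1 -> forall i j,
      `|t * A1 i j + t / (t * q + e) * A2 i j +
        t * (t / (t * q + e)) * A3 i j| < d].
Proof.
move=> d0; pose S (A : 'M[F]_(k, n)) : F := \sum_i \sum_j `|A i j|.
have SE (A : 'M[F]_(k, n)) i j : `|A i j| <= S A.
  rewrite /S (bigD1 i) //= (bigD1 j) //= -addrA ler_wpDr //.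
  by rewrite addr_ge0 ?sumr_ge0 // => *; rewrite ?sumr_ge0.
have S0 A : 0 <= S A by apply: sumr_ge0 => *; apply: sumr_ge0.
pose C := S A1 + S A2 + S A3; have C0 : 0 <= C by rewrite !addr_ge0.
(* With [t = D^-1] the first summand gives [`|t * q| <= 1 / 2] and [t <= 1 / 2],
   hence [`|t / (t * q + e)| <= 2 * t]; the second gives [4 * t * C < d]. *)
pose D := 2 * (`|q| + 1) + (4 * C + 1) / d.
have D1 : 2 * (`|q| + 1) < D by rewrite ltr_pwDr // divr_gt0 // ltr_wpDl ?mulr_ge0.
have D0 : 0 < D by apply: lt_trans D1; rewrite mulr_gt0 // ltr_wpDl.
have D2 : (4 * C + 1) / d <= D by rewrite lerDr mulr_ge0 // addr_ge0.
have t0 : 0 < D^-1 by rewrite invr_gt0.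
have nt : `|D^-1| = D^-1 by apply: gtr0_norm.
have tq : `|D^-1 * q| <= 2^-1.
  rewrite normrM nt ler_pdivrMl // ler_pdivlMr // mulrC.
  by apply: le_trans (ltW D1); rewrite ler_pM2l // lerDl.
have t1 : D^-1 <= 2^-1.
  rewrite lef_pV2 ?posrE //; apply: le_trans (ltW D1).
  by rewrite -[leLHS]mulr1 ler_pM2l // lerDr.
have h1 : (2^-1 : F) < 1 by rewrite invf_lt1 // ltr1n.
exists D^-1; split; [by rewrite gt_eqF | exact: le_lt_trans tq h1 |].
move=> e e2 i j; set Z := _ * q + e; set t := D^-1 in nt t0 t1 tq Z *.
have e1 : `|e| = 1 by apply/eqP; rewrite -sqrp_eq1 // -normrX e2 normr1.
have Z1 : 2^-1 <= `|Z|.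
  have := lerB_dist e (- (D^-1 * q)).
  rewrite opprK (addrC e) -/Z normrN e1 => h; apply: le_trans h.
  by rewrite lerBrDr -lerBrDl (le_trans tq) // {2}[1](splitr 1) div1r addrK.
have Z0 : 0 < `|Z| by apply: lt_le_trans Z1; rewrite invr_gt0.
have zt : `|t / Z| <= t * 2.
  by rewrite normrM (normfV Z) nt ler_pM2l // -[2]invrK lef_pV2 ?posrE ?invr_gt0 // ltr0n.
apply: (@le_lt_trans _ _ (t * (4 * C))); last first.
  rewrite [ltLHS]mulrC ltr_pdivrMr // [ltRHS]mulrC -ltr_pdivrMr //.
  by apply: lt_le_trans D2; rewrite ltr_pM2r ?invr_gt0 // ltrDl.
have -> : t * (4 * C) = t * 4 * S A1 + t * 4 * S A2 + t * 4 * S A3.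
  by rewrite /C; ring.
have t4 : t * 2 <= t * 4 by rewrite ler_pM2l // ler_nat.
apply: le_trans (ler_normD _ _) _; apply: lerD.
  apply: le_trans (ler_normD _ _) _; apply: lerD; rewrite normrM ler_pM //.
    by rewrite nt -[leLHS]mulr1 ler_pM2l // ler1n.
  exact: le_trans zt t4.
rewrite normrM ler_pM // normrM nt ler_pM2l //.
apply: le_trans zt _; apply: (@le_trans _ _ 2); last by rewrite ler_nat.
by rewrite -[leRHS]mul1r ler_pM2r // (le_trans t1) // ltW.
Qed.

End Spans.

(** * The closure of a Deodhar component *)

Section Assembly.
Variables (F : numFieldType) (k n : nat) (lam : seq nat).
Hypotheses (hkn : (k <= n)%N) (hlam : is_partition k n lam).
Implicit Types (D : pipe_dream) (s w : seq cell).

Definition cell_letter D (b : cell) : letter :=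
  (cell_index k n b, symbol_at k n lam D b).

Lemma word_mx_of_G w D (g : 'M[F]_n) : (forall b, b \in w -> in_shape lam b) ->
  @G_ F k n lam w D g -> word_mx [seq cell_letter D b | b <- w] g.
Proof.
move=> mw [p [hp ->]]; elim: w mw => [|b w IH] mw; first by rewrite big_nil.
rewrite big_cons /=; exists (p b), (\big[mulmx/1%:M]_(a <- w) Defs.factor k n lam D p a).
split=> //; first by apply: hp; apply: mw; rewrite mem_head.
by apply: IH => a aw; apply: mw; rewrite inE aw orbT.
Qed.

Lemma G_of_word_mx w D (g : 'M[F]_n) : uniq w -> (forall b, in_shape lam b -> b \in w) ->
  word_mx [seq cell_letter D b | b <- w] g -> @G_ F k n lam w D g.
Proof.
move=> uw mw hg; suff [p [hp ->]] : exists p : cell -> F,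
    (forall b, b \in w -> symbol_at k n lam D b = Plus -> p b != 0) /\
    g = \big[mulmx/1%:M]_(b <- w) Defs.factor k n lam D p b.
  by exists p; split=> // b /mw; apply: hp.
elim: w uw g hg {mw} => [|b w IH] /= => [_ g ->|/andP[bw uw] g [pb [M [hpb hM ->]]]].
  by exists (fun=> 0); rewrite big_nil.
have [p [hp ->]] := IH uw M hM; exists (fun a => if a == b then pb else p a); split.
  by move=> a; rewrite inE; case: eqP => [->|_] //=; apply: hp.
rewrite big_cons; congr (_ *m _); first by rewrite /Defs.factor eqxx.
apply: eq_big_seq => a aw; rewrite /Defs.factor; case: eqP => // ab.
by rewrite ab (negbTE bw) in aw.
Qed.

Lemma turn_cell D sg b : turn n sg (cell_letter D b) = relabel k n D sg b.
Proof.
by rewrite /turn /relabel /= /symbol_at; case: (D b) => //; case: ifP.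
Qed.

Lemma foldl_turn_cells D sg s :
  foldl (turn n) sg [seq cell_letter D b | b <- s] = foldl (relabel k n D) sg s.
Proof. by elim: s sg => [|b s IH] sg //=; rewrite IH turn_cell. Qed.

Lemma admissible_cells kap D pre s :
  (forall b, b \in s -> in_shape lam b) ->
  (forall x b y, s = x ++ b :: y ->
    consistent (kap \o labelling k n D (pre ++ x)) (south_row k n b) (symbol_at k n lam D b)) ->
  admissible n kap (labelling k n D pre) [seq cell_letter D b | b <- s].
Proof.
elim: s pre => [|b s IH] pre //= hs h; split.
- by apply: (cell_index_bounds hkn hlam); apply: hs; rewrite mem_head.
- by have := h [::] b s erefl; rewrite cats0.
rewrite turn_cell -labelling_rcons; apply: IH => [a ha|x a y e].
  by apply: hs; rewrite inE ha orbT.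
by rewrite cat_rcons; apply: (h (b :: x)); rewrite e.
Qed.

Lemma glue_consistent l f u sy : consistent f u sy ->
  ~ perm_eq [:: f u.+1; f u] [:: l; l.+1] -> consistent (glue l \o f) u sy.
Proof.
move=> h nm; have h1 : ~ (f u.+1 = l /\ f u = l.+1) by move=> [e1 e2]; rewrite e1 e2 in nm.
have h2 : ~ (f u.+1 = l.+1 /\ f u = l).
  by move=> [e1 e2]; apply: nm; rewrite e1 e2 (perm_catC [:: l.+1] [:: l]).
by move: h; rewrite /consistent /glue /=; case: sy; repeat case: ifP; lia.
Qed.

Lemma deodhar_sub_closure (D' : pipe_dream) (c c' : cell) (i : nat) w :
  go_diagram k n lam D' -> crossing_uncrossing_pair k n lam D' c c' ->
  (0 < i)%N -> perm_eq (pipes k n lam D' c) [:: i; i.+1] -> reading_word lam w ->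
  @deodhar F k n lam hkn w D' `<=`
    closure (@deodhar F k n lam hkn w (replace_by_elbows D' c c')).
Proof.
move=> go pr i0 hp hw; set D := replace_by_elbows D' c c'.
have [uw mw _ _] := hw.
have [[hc hc'] _ _ _ _] := pr.
have [w1 [w2 [w3 ew]]] := word_split hkn hlam hw pr.
have ewc' : w = (rcons w1 c ++ w2) ++ c' :: w3 by rewrite ew cat_rcons -catA.
have ew3 : w = rcons (rcons w1 c ++ w2) c' ++ w3 by rewrite cat_rcons.
have [lE lS cr] := labels_c pr hp; have [lE' lS' cr'] := labels_c' pr hp.
have sy : symbol_at k n lam D' c = White by case: pr => _ _ _ [].
have sy' : symbol_at k n lam D' c' = Black by case: pr => _ _ _ [].
rewrite (pipe_in_labelling hkn hlam hw _ _ ew) /= in lE.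
rewrite (pipe_in_labelling hkn hlam hw _ _ ew) /= in lS.
rewrite (pipe_in_labelling hkn hlam hw _ _ ewc') /= in lE'.
rewrite (pipe_in_labelling hkn hlam hw _ _ ewc') /= in lS'.
have bounds := cell_index_bounds hkn hlam.
have inw s : {subset s <= w} -> forall b, b \in s -> in_shape lam b.
  by move=> ss b /ss; rewrite mw.
have sub1 : {subset w1 <= w} by move=> b; rewrite ew mem_cat => ->.
have sub2 : {subset w2 <= w}.
  by move=> b; rewrite ew mem_cat inE mem_cat => ->; rewrite !orbT.
have sub3 : {subset w3 <= w}.
  by move=> b; rewrite ew mem_cat inE mem_cat inE => ->; rewrite !orbT.
have symD b : b \in w -> b != c -> b != c' -> cell_letter D b = cell_letter D' b.
  move=> bw n1 n2; congr (_, _).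
  by apply: (replace_symbol hkn hlam hw go i0 ew pr hp); rewrite -?mw.
have [n1 n2 n3 n4 [n5 n6]] := word_notin hw ew.
have mapD s : {subset s <= w} -> c \notin s -> c' \notin s ->
    [seq cell_letter D b | b <- s] = [seq cell_letter D' b | b <- s].
  move=> ss cs cs'; apply/eq_in_map => b bs; apply: symD; first exact: ss.
    by apply: contraNneq cs => <-.
  by apply: contraNneq cs' => <-.
pose L s := [seq cell_letter D' b | b <- s].
set ic := cell_index k n c; set ic' := cell_index k n c'.
have lc : cell_letter D' c = (ic, White) by rewrite /cell_letter sy.
have lc' : cell_letter D' c' = (ic', Black) by rewrite /cell_letter sy'.
have lD b : b = c \/ b = c' -> cell_letter D b = (cell_index k n b, Plus).
  by move=> hb; rewrite /cell_letter replace_symbol_pair.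
have LD' : [seq cell_letter D' b | b <- w] =
    L w1 ++ (ic, White) :: L w2 ++ (ic', Black) :: L w3.
  by rewrite ew map_cat /= map_cat /= lc lc'.
have LD : [seq cell_letter D b | b <- w] =
    L w1 ++ (ic, Plus) :: L w2 ++ (ic', Plus) :: L w3.
  rewrite ew map_cat /= map_cat /= !mapD //.
  by rewrite !lD; auto.
move=> V [g0 Gg0 eV].
have := word_mx_of_G (inw w (fun _ h => h)) Gg0.
rewrite LD' => /word_mx_cat[M1 [R1 [h1 [p [R2 [_ + ->]]] e0]]].
case/word_mx_cat=> M2 [R3 [h2 [q [M3 [_ h3 eR3]]] eR2]].
move: e0; rewrite eR2 eR3.
rewrite /letter_mx /=; move eX : (x_ n ic' q *m _) => X e0.
have hic : (0 < ic < n)%N by apply: bounds.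
have hic' : (0 < ic' < n)%N by apply: bounds.
have allL s : {subset s <= w} -> all (fun l : letter => 0 < l.1 < n)%N (L s).
  move=> ss; rewrite all_map; apply/allP => b bs; apply: bounds; exact: (inw s).
have u1 := word_unit (allL _ sub1) h1.
have u2 := word_unit (allL _ sub2) h2.
have u3 := word_unit (allL _ sub3) h3.
have us : sdot F n ic \in unitmx by exact: (@letter_unit F n (ic, White) 0 hic).
have uX : X \in unitmx by rewrite -eX; exact: (@letter_unit F n (ic', Black) q hic').
(* [K t z] deforms [g0 = K 0 0]; its entries are polynomials in [t] and [z]. *)
have [E1 hE1] := x_affine F hic; have [E2 hE2] := x_affine F hic'.
pose K t z := M1 *m (x_ n ic t *m sdot F n ic *m M2 *m (X *m x_ n ic' z) *m M3).
have uK t z : K t z \in unitmx.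
  by rewrite !unitmx_mul u1 u2 u3 us uX !x_unit.
have K0 : g0 = K 0 0.
  by rewrite e0 /K hE1 hE2 !scale0r !addr0 mul1mx mulmx1 !mulmxA.
have KE t z : K t z = g0 + t *: (M1 *m E1 *m sdot F n ic *m M2 *m X *m M3) +
    z *: (M1 *m sdot F n ic *m M2 *m X *m E2 *m M3) +
    (t * z) *: (M1 *m E1 *m sdot F n ic *m M2 *m X *m E2 *m M3).
  rewrite e0 /K hE1 hE2; rewrite !(mulmxDl, mulmxDr) ?mul1mx ?mulmx1.
  by rewrite -!(scalemxAl, scalemxAr) ?scalerA !mulmxA addrACA !addrA.
have -> : V = Gr_of_frame (frame_of (unit_frame hkn (uK 0 0))).
  by apply: val_inj; rewrite /= -K0.
apply: closure_Gr => d d0.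
pose A1 := bottom_up_mx hkn (M1 *m E1 *m sdot F n ic *m M2 *m X *m M3).
pose A2 := bottom_up_mx hkn (M1 *m sdot F n ic *m M2 *m X *m E2 *m M3).
pose A3 := bottom_up_mx hkn (M1 *m E1 *m sdot F n ic *m M2 *m X *m E2 *m M3).
have [t [t0 tq small]] := small_deformation A1 A2 A3 q d0.
have st1 : turn n (labelling k n D' w1) (ic, White) = labelling k n D' (rcons w1 c).
  by rewrite labelling_rcons -turn_cell lc.
have st2 : foldl (turn n) (labelling k n D' (rcons w1 c)) (L w2) =
    labelling k n D' (rcons w1 c ++ w2).
  by rewrite foldl_turn_cells labelling_cat.
have st3 : turn n (labelling k n D' (rcons w1 c ++ w2)) (ic', Black) =
    labelling k n D' (rcons (rcons w1 c ++ w2) c').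
  by rewrite labelling_rcons -turn_cell lc'.
have [|||||e [M [b [e2 hM pb eK]]]] := @deform F n i (labelling k n D' w1) ic ic'
    (L w2) (L w3) M2 M3 t q hic hic' i0 (@labelling_inj _ _ _ _) _ lS lE _ _ _ _ h2 h3 t0 tq.
- by rewrite st1 st2; apply: labelling_inj.
- by rewrite st1 st2.
- by rewrite st1 st2.
- rewrite st1; apply: admissible_cells (inw _ sub2) _ => x b y e.
  have eb : w = (rcons w1 c ++ x) ++ b :: y ++ c' :: w3.
    by rewrite ewc' e -!catA.
  apply: glue_consistent; first exact: (go_consistent hkn hlam hw go eb).
  have [nm _] := no_meeting hkn hlam hw go i0 ew pr hp (esym (cats0 w2)).
  have := nm x b y e.
  by rewrite /pipes !(pipe_in_labelling hkn hlam hw D' _ eb).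
- rewrite st1 st2 st3; apply: admissible_cells (inw _ sub3) _ => x b y e.
  apply: (go_consistent hkn hlam hw go (s2 := y)).
  by rewrite ew3 e catA.
have eqK : K t (t / (t * q + e)) = (M1 *m M) *m b.
  by rewrite -mulmxA -eK eX.
exists (frame_of (unit_frame hkn (uK t (t / (t * q + e))))); split.
  exists (M1 *m M); last first.
    by rewrite /= eqK (row_span_mul hkn pb) // -eqK.
  apply: (G_of_word_mx uw) => [a ha|]; first by rewrite mw.
  by rewrite LD; apply/word_mx_cat; exists M1, M.
move=> r j; have := small e e2 r j; rewrite /= -K0 KE /A1 /A2 /A3.
rewrite !mxE; congr (`|_| < d); ring.
Qed.

End Assembly.

Theorem theorem4p11 (R : realType) (F : numFieldType)
    (hF : F = (R : numFieldType) \/ F = (R[i] : numFieldType))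
    (k n : nat) (hkn : (k <= n)%N)
    (lam : seq nat) (hlam : is_partition k n lam)
    (D' : pipe_dream) (hD' : go_diagram k n lam D')
    (c c' : cell) (hcc' : crossing_uncrossing_pair k n lam D' c c')
    (i : nat) (hi : (1 <= i < n)%N)
    (hpipes : perm_eq (pipes k n lam D' c) [:: i; i.+1]) :
  let D := replace_by_elbows D' c c' in
  go_diagram k n lam D /\
  (forall w : seq cell, reading_word lam w ->
     @deodhar F k n lam hkn w D' `<=` closure (@deodhar F k n lam hkn w D)).
Proof.
have /andP[i0 _] := hi; split=> [|w hw]; last exact: deodhar_sub_closure hcc' i0 hpipes hw.
have [w hw] := reading_word_exists hlam.
have [w1 [w2 [w3 ew]]] := word_split hkn hlam hw hcc'.
exact: (replace_go hkn hlam hw hD' i0 ew hcc' hpipes).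
Qed.
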